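(* Let $\mathcal T_0$ be a theory with the following properties: Assumption 1: $\mathcal T_0$ is convex with respect to the set $\mathsf{Pred}$ (including equality $\approx$); Assumption 2: $\mathcal T_0$ is $P$-interpolating with respect to a subset $P\subseteq\mathsf{Pred}$ and the separating terms $t_i$ can be effectively computed; Assumption 3: $\mathcal T_0$ has ground interpolation. Assume that the extension $\mathcal T_1=\mathcal T_0\cup\mathcal K$ of $\mathcal T_0$ has the following properties: Assumption 4: $\mathcal T_1$ is a local extension of $\mathcal T_0$; Assumption 5: $\mathcal K$ consists of the following type of combinations of clauses: $$\begin{cases}x_1R_1s_1\wedge\dots\wedge x_nR_ns_n\rightarrow f(x_1,\dots,x_n)\,R\,g(y_1,\dots,y_n)\\ x_1R_1y_1\wedge\dots\wedge x_nR_ny_n\rightarrow f(x_1,\dots,x_n)\,R\,f(y_1,\dots,y_n)\end{cases}$$ where $n\ge1$, $x_1,\dots,x_n$ are variables, $R_1,\dots,R_n,R$ are binary relations, $R_1,\dots,R_n\in P$, $R$ is transitive, and each $s_i$ is either a variable among the arguments of $g$, or a term of the form $f_i(z_1,\dots,z_k)$, where $f_i\in\Sigma_1$ and all the arguments of $f_i$ are variables occurring among the arguments of $g$. Then for every conjunction $A\wedge B$ of ground unit clauses in the signature $\Pi^c$ of $\mathcal T_1$ (possibly containing additional constants) with $A\wedge B\models_{\mathcal T_1}\perp$, the procedure for hierarchical interpolation (see context) terminates and computes an interpolant $I$ for $A\wedge B$.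
   Context: $\mathcal T_0$ has signature $\Pi_0=(\Sigma_0,\mathsf{Pred})$; $\mathcal K$ is a set of universally quantified clauses in $\Pi=(\Sigma_0\cup\Sigma_1,\mathsf{Pred})$, where $\Sigma_1$ are the extension functions; models of $\mathcal T_1$ are $\Pi$-structures satisfying $\mathcal K$ with $\Pi_0$-reduct a model of $\mathcal T_0$. $\Pi^c$ is $\Pi$ extended with a set $\Sigma_c$ of new constants. Interpolant for $A\wedge B$: a ground formula $I$ containing only constants and extension functions common to $A$ and $B$ with $A\models_{\mathcal T_1}I$ and $I\wedge B\models_{\mathcal T_1}\perp$. Here, with $\sim$ the equivalence relation on $\Sigma_1$ determined by $f\sim g$ if $f,g$ occur in the same clause of $\mathcal K$, a function $f\in\Sigma_1$ is considered common to $A$ and $B$ if there are $g,h\in\Sigma_1$ with $f\sim g$, $f\sim h$, $g$ occurring in $A$ and $h$ occurring in $B$. Convexity: for all conjunctions $\Gamma$ of ground atoms, $R_1,\dots,R_m\in\mathsf{Pred}$, ground tuples $\overline t_1,\dots,\overline t_m$, if $\Gamma\models_{\mathcal T_0}\bigvee_iR_i(\overline t_i)$ then $\Gamma\models_{\mathcal T_0}R_j(\overline t_j)$ for some $j$. $P$-interpolating: for all conjunctions $A,B$ of ground literals, binary $R\in P$, constants $a$ in $A$ and $b$ in $B$ (or vice versa), if $A\wedge B\models_{\mathcal T_0}a\,R\,b$ then there is a (separating) term $t$ containing only constants common to $A$ and $B$ with $A\wedge B\models_{\mathcal T_0}a\,R\,t\wedge t\,R\,b$. Ground interpolation: whenever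 $A\wedge B\models_{\mathcal T_0}\perp$ for ground (sets of) clauses, there is a ground formula $I$ containing only constants common to $A$ and $B$ with $A\models_{\mathcal T_0}I$ and $B\wedge I\models_{\mathcal T_0}\perp$. Locality: a partial structure (function symbols interpreted by partial functions) weakly satisfies a clause $C$ if under every assignment some term of $C$ is undefined or all terms are defined and some literal of $C$ is true. For a set $G$ of ground $\Pi^c$-clauses, $\mathsf{st}(\mathcal K,G)$ is the set of ground terms occurring in $G$ or $\mathcal K$, and $\mathcal K[G]$ is the set of instances of $\mathcal K$ in which all terms starting with a symbol in $\Sigma_1$ are in $\mathsf{st}(\mathcal K,G)$. The extension is local if for every finite set $G$ of ground clauses, $G\models_{\mathcal T_1}\perp$ iff there is no partial $\Pi^c$-structure whose $\Pi_0$-reduct is a total model of $\mathcal T_0$, in which all terms in $\mathsf{st}(\mathcal K,G)$ are defined and which weakly satisfies $\mathcal K[G]\wedge G$. Procedure for hierarchical interpolation. Step 1 (purify): flatten and purify $A$ and $B$ by introducing new constants for arguments of, and terms starting with, extension functions, giving $A_0\wedge D_A$ and $B_0\wedge D_B$, where $D_A,D_B$ consist of definitions $f(c_1,\dots,c_n)\approx c$ ($f\in\Sigma_1$, constants $c_i,c$) and $A_0,B_0$ have no $\Sigma_1$-symbols. Put $\mathcal H=\mathcal K_0\wedge\mathsf{Con}[D_A\wedge D_B]_0$, where $\mathcal K_0$ is obtained from $\mathcal K[D_A\wedge D_B]$ by replacing the $\Sigma_1$-terms with the corresponding constants of the definitions, and $\mathsf{Con}[D_A\wedge D_B]_0=\bigwedge\{\bigwedge_ic_i\approx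 d_i\rightarrow c\approx d\mid f(c_1,\dots,c_n)\approx c,\ f(d_1,\dots,d_n)\approx d\in D_A\cup D_B\}$. A clause $\bigwedge_ic_iR_id_i\rightarrow cRd$ of $\mathcal H$ is mixed if $c_i,c$ are constants of $A$ and $d_i,d$ constants of $B$, or conversely; $\mathcal H_{\sf mix}$ is the set of mixed clauses. Let $\Delta:=\top$. Step 2 (reduction to an interpolation problem in the base theory): repeat as long as possible: let $C\in\mathcal H$ be a clause whose premise is entailed (w.r.t. $\mathcal T_0$) by $A_0\wedge B_0\wedge\Delta$. If $C=\bigwedge_ic_iR_id_i\rightarrow cRd$ is mixed, with $c\approx f(c_1,\dots,c_n)$ among the definitions on one side and $d\approx g(\overline e)$, $d_i\approx s_i(\overline e)$ on the other, compute terms $t_i$ over common constants separating the premises ($A_0\wedge B_0\wedge\Delta\models_{\mathcal T_0}c_iR_it_i\wedge t_iR_id_i$), remove $C$ from $\mathcal H$, and add $C_1=\bigwedge_ic_iR_it_i\rightarrow c\,R\,c_{f(t_1,\dots,t_n)}$ and $C_2=\bigwedge_it_iR_id_i\rightarrow c_{f(t_1,\dots,t_n)}\,R\,d$ to $\mathcal H_{\sf sep}$ and their conclusions to $\Delta$, where $c_{f(t_1,\dots,t_n)}$ is a new constant, considered common, denoting $f(t_1,\dots,t_n)$. Otherwise move $C$ to $\mathcal H_{\sf sep}$ and add its conclusion to $\Delta$. Step 3: compute an interpolant $I_0$ in $\mathcal T_0$ for the separated formula $\overline A_0\wedge\overline B_0$ (logically equivalent to $A_0\wedge B_0\wedge(\mathcal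 H\setminus\mathcal H_{\sf mix})\wedge\mathcal H_{\sf sep}$) obtained this way, i.e. the conjunction of the literals of $A_0$, $B_0$ and the conclusions of these clauses, split into the part over $A$-side and common constants and the part over $B$-side and common constants. Step 4: construct $I$ from $I_0$ by recursively replacing each constant $c_t$ introduced in the process with the term $t$ it denotes.
   Formalization: Equality ≈ is assumed to belong to P; 𝒦 is finite; in Step 3 the separated formula is built from the clauses of (H∖H_mix)∧H_sep themselves, not only from their conclusions, since with conclusions alone the result need not be entailed by A. *)

(* Defs.v *)
(* Plain MathComp, with Stdlib's list membership [List.In] and relational
   closures, because no decidability of the symbols is assumed. *)
From Stdlib Require List.
From Stdlib Require Import Relation_Operators.
From mathcomp Require Import all_boot.

Set Implicit Arguments.
Unset Strict Implicit.
Unset Printing Implicit Defensive.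

Notation In := List.In.

(* Symbols are indexed by their arity.  [Pr] is Pred; equality is one of its
   binary symbols. *)
Record signature : Type := Signature {
  F0 : nat -> Type;
  F1 : nat -> Type;
  Pr : nat -> Type;
  peq : Pr 2 }.

(* Function symbols of the extended signature: Sigma_0 (inl) and Sigma_1 (inr). *)
Definition F01 (S : signature) (n : nat) : Type := (F0 S n + F1 S n)%type.

(* Leaves are the constants of Sigma_c in ground terms, and the variables in the
   clauses of K.  Only leaves count as constants in "common constants": nullary
   symbols in [F 0] belong to the signature. *)
Inductive term (F : nat -> Type) (X : Type) : Type :=
| Leaf (x : X)
| App (n : nat) (f : F n) (a : 'I_n -> term F X).
Arguments Leaf {F X} x.
Arguments App {F X n} f a.

Record atom (S : signature) (F : nat -> Type) (X : Type) : Type := Atom {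
  aar : nat;
  apr : Pr S aar;
  aargs : 'I_aar -> term F X }.
Arguments Atom {S F X aar} apr aargs.
Arguments aargs {S F X} a i.

(* A literal is a sign ([true] for positive) and an atom. *)
Definition literal (S : signature) F X : Type := (bool * atom S F X)%type.

(* A [seq (literal S F X)] is read disjunctively when it is a clause
   ([holds_clause]), conjunctively when it is a conjunction of unit clauses
   ([holds_all]). *)
Definition clause (S : signature) F X : Type := seq (literal S F X).

Inductive formula (S : signature) (F : nat -> Type) (X : Type) : Type :=
| FTrue
| FFalse
| FAtom (p : atom S F X)
| FNot (p : formula S F X)
| FAnd (p q : formula S F X)
| FOr (p q : formula S F X).
Arguments FTrue {S F X}.
Arguments FFalse {S F X}.

Definition pair2 (T : Type) (x y : T) : 'I_2 -> T :=
  fun i => if val i == 0 then x else y.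

Definition atom2 (S : signature) F X (R : Pr S 2) (t u : term F X) : atom S F X :=
  Atom R (pair2 t u).

Definition horn_form (S : signature) F X (prem : seq (atom S F X))
    (concl : atom S F X) : clause S F X :=
  [seq (false, p) | p <- prem] ++ [:: (true, concl)].

Fixpoint subterms F X (t : term F X) : seq (term F X) :=
  t :: match t with
       | Leaf _ => [::]
       | App n _ a => flatten [seq subterms (a i) | i <- enum 'I_n]
       end.

Definition asub (S : signature) F X (p : atom S F X) : seq (term F X) :=
  flatten [seq subterms (aargs p i) | i <- enum 'I_(aar p)].

Definition lsub (S : signature) F X (L : seq (literal S F X)) : seq (term F X) :=
  flatten [seq asub l.2 | l <- L].

Fixpoint fsub (S : signature) F X (p : formula S F X) : seq (term F X) :=
  match p with
  | FTrue | FFalse => [::]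
  | FAtom q => asub q
  | FNot q => fsub q
  | FAnd q r | FOr q r => fsub q ++ fsub r
  end.

(* [ts] is meant to be a subterm-closed list, as computed by the functions above. *)
Definition leaf_in F X (x : X) (ts : seq (term F X)) : Prop := In (Leaf x) ts.

Definition ext_in (S : signature) X (n : nat) (f : F1 S n)
    (ts : seq (term (F01 S) X)) : Prop :=
  exists a, In (App (inr f : F01 S n) a) ts.

Definition ext_headed (S : signature) X (t : term (F01 S) X) : Prop :=
  exists n (f : F1 S n) a, t = App (inr f : F01 S n) a.

Fixpoint bind F X Y (s : X -> term F Y) (t : term F X) : term F Y :=
  match t with
  | Leaf x => s x
  | App _ f a => App f (fun i => bind s (a i))
  end.

Definition abind (S : signature) F X Y (s : X -> term F Y) (p : atom S F X) :
    atom S F Y :=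
  Atom (apr p) (fun i => bind s (aargs p i)).

Definition cbind (S : signature) F X Y (s : X -> term F Y) (C : clause S F X) :
    clause S F Y :=
  [seq (l.1, abind s l.2) | l <- C].

Fixpoint fbind (S : signature) F X Y (s : X -> term F Y) (p : formula S F X) :
    formula S F Y :=
  match p with
  | FTrue => FTrue
  | FFalse => FFalse
  | FAtom q => FAtom (abind s q)
  | FNot q => FNot (fbind s q)
  | FAnd q r => FAnd (fbind s q) (fbind s r)
  | FOr q r => FOr (fbind s q) (fbind s r)
  end.

Fixpoint embed (S : signature) X (t : term (F0 S) X) : term (F01 S) X :=
  match t with
  | Leaf x => Leaf x
  | App n f a => App (inl f : F01 S n) (fun i => embed (a i))
  end.

Definition aembed (S : signature) X (p : atom S (F0 S) X) : atom S (F01 S) X :=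
  Atom (apr p) (fun i => embed (aargs p i)).

Fixpoint fembed (S : signature) X (p : formula S (F0 S) X) :
    formula S (F01 S) X :=
  match p with
  | FTrue => FTrue
  | FFalse => FFalse
  | FAtom q => FAtom (aembed q)
  | FNot q => FNot (fembed q)
  | FAnd q r => FAnd (fembed q) (fembed r)
  | FOr q r => FOr (fembed q) (fembed r)
  end.

Record structure (S : signature) (F : nat -> Type) : Type := Structure {
  car : Type;
  car_inh : inhabited car;
  ifun : forall n, F n -> ('I_n -> car) -> car;
  irel : forall n, Pr S n -> ('I_n -> car) -> Prop;
  irel_eq : forall x y, irel (peq S) (pair2 x y) <-> x = y }.

(* A theory is given by its class of models. *)
Definition theory (S : signature) (F : nat -> Type) : Type :=
  structure S F -> Prop.

Fixpoint eval (S : signature) F X (M : structure S F) (v : X -> car M)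
    (t : term F X) : car M :=
  match t with
  | Leaf x => v x
  | App _ f a => ifun f (fun i => eval v (a i))
  end.

Definition holds_atom (S : signature) F X (M : structure S F) (v : X -> car M)
    (p : atom S F X) : Prop :=
  irel (apr p) (fun i => eval v (aargs p i)).

Definition holds_lit (S : signature) F X (M : structure S F) (v : X -> car M)
    (l : literal S F X) : Prop :=
  if l.1 then holds_atom v l.2 else ~ holds_atom v l.2.

Definition holds_all (S : signature) F X (M : structure S F) (v : X -> car M)
    (L : seq (literal S F X)) : Prop :=
  forall l, In l L -> holds_lit v l.

Definition holds_clause (S : signature) F X (M : structure S F) (v : X -> car M)
    (C : clause S F X) : Prop :=
  exists l, In l C /\ holds_lit v l.

Definition holds_clauses (S : signature) F X (M : structure S F)
    (v : X -> car M) (G : seq (clause S F X)) : Prop :=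
  forall C, In C G -> holds_clause v C.

Fixpoint holds (S : signature) F X (M : structure S F) (v : X -> car M)
    (p : formula S F X) : Prop :=
  match p with
  | FTrue => True
  | FFalse => False
  | FAtom q => holds_atom v q
  | FNot q => ~ holds v q
  | FAnd q r => holds v q /\ holds v r
  | FOr q r => holds v q \/ holds v r
  end.

Definition entails_lit (S : signature) F X (T : theory S F)
    (L : seq (literal S F X)) (l : literal S F X) : Prop :=
  forall M, T M -> forall v : X -> car M, holds_all v L -> holds_lit v l.

Definition entails_atom (S : signature) F X (T : theory S F)
    (L : seq (literal S F X)) (p : atom S F X) : Prop :=
  entails_lit T L (true, p).

Definition unsat (S : signature) F X (T : theory S F)
    (L : seq (literal S F X)) : Prop :=
  forall M, T M -> forall v : X -> car M, ~ holds_all v L.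

Definition unsat_clauses (S : signature) F X (T : theory S F)
    (G : seq (clause S F X)) : Prop :=
  forall M, T M -> forall v : X -> car M, ~ holds_clauses v G.

Definition reduct (S : signature) (N : structure S (F01 S)) :
    structure S (F0 S) :=
  @Structure S (F0 S) (car N) (car_inh N)
    (fun n f => ifun (inl f : F01 S n)) (@irel _ _ N) (@irel_eq _ _ N).

(* The extension T_1 of [T0] with the universally quantified clauses [K]. *)
Definition extension (S : signature) (T0 : theory S (F0 S))
    (K : seq (clause S (F01 S) nat)) : theory S (F01 S) :=
  fun N => T0 (reduct N) /\ forall v : nat -> car N, holds_clauses v K.

Definition convex (S : signature) (cst : Type) (T0 : theory S (F0 S)) : Prop :=
  forall (Gamma ps : seq (atom S (F0 S) cst)),
    ps <> [::] ->
    (forall M, T0 M -> forall v : cst -> car M,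
       holds_all v [seq (true, p) | p <- Gamma] ->
       exists p, In p ps /\ holds_atom v p) ->
    exists p, In p ps /\ entails_atom T0 [seq (true, p) | p <- Gamma] p.

(* [T0] is [P]-interpolating, and [sep] computes the separating terms. *)
Definition P_interpolating (S : signature) (cst : Type) (T0 : theory S (F0 S))
    (P : Pr S 2 -> Prop)
    (sep : seq (literal S (F0 S) cst) -> seq (literal S (F0 S) cst) ->
           Pr S 2 -> cst -> cst -> term (F0 S) cst) : Prop :=
  forall (A B : seq (literal S (F0 S) cst)) (R : Pr S 2) (a b : cst),
    P R ->
    (leaf_in a (lsub A) /\ leaf_in b (lsub B)) \/
    (leaf_in a (lsub B) /\ leaf_in b (lsub A)) ->
    entails_atom T0 (A ++ B) (atom2 R (Leaf a) (Leaf b)) ->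
    let t := sep A B R a b in
    [/\ forall c, leaf_in c (subterms t) -> leaf_in c (lsub A) /\ leaf_in c (lsub B),
        entails_atom T0 (A ++ B) (atom2 R (Leaf a) t)
      & entails_atom T0 (A ++ B) (atom2 R t (Leaf b))].

Definition interpolant0 (S : signature) (cst : Type) (T0 : theory S (F0 S))
    (A B : seq (clause S (F0 S) cst)) (I : formula S (F0 S) cst) : Prop :=
  [/\ forall c, leaf_in c (fsub I) ->
        leaf_in c (lsub (flatten A)) /\ leaf_in c (lsub (flatten B)),
      forall M, T0 M -> forall v : cst -> car M, holds_clauses v A -> holds v I
    & forall M, T0 M -> forall v : cst -> car M,
        ~ (holds v I /\ holds_clauses v B)].

Definition ground_interpolation (S : signature) (cst : Type)
    (T0 : theory S (F0 S)) : Prop :=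
  forall A B : seq (clause S (F0 S) cst),
    unsat_clauses T0 (A ++ B) -> exists I, interpolant0 T0 A B I.

Definition transitive_rel (S : signature) (T0 : theory S (F0 S))
    (R : Pr S 2) : Prop :=
  forall M, T0 M -> forall x y z : car M,
    irel R (pair2 x y) -> irel R (pair2 y z) -> irel R (pair2 x z).

(* Partial structures over the extended signature with constants: the reduct to
   the base signature is total, extension functions and the constants of Sigma_c
   may be partial. *)
Record pstructure (S : signature) (cst : Type) : Type := PStructure {
  pbase : structure S (F0 S);
  pext : forall n, F1 S n -> ('I_n -> car pbase) -> option (car pbase);
  pcst : cst -> option (car pbase) }.
Arguments pext {S cst} p {n} f v.

(* [peval t d]: the term [t] is defined and has value [d]. *)
Inductive peval (S : signature) (cst : Type) (N : pstructure S cst) :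
    term (F01 S) cst -> car (pbase N) -> Prop :=
| PLeaf c d : pcst N c = Some d -> peval (Leaf c) d
| PBase n (f : F0 S n) a v :
    (forall i, peval (a i) (v i)) ->
    peval (App (inl f : F01 S n) a) (ifun f v)
| PExt n (f : F1 S n) a v d :
    (forall i, peval (a i) (v i)) -> pext N f v = Some d ->
    peval (App (inr f : F01 S n) a) d.

Definition pdefined (S : signature) (cst : Type) (N : pstructure S cst)
    (t : term (F01 S) cst) : Prop :=
  exists d, @peval S cst N t d.

(* For a literal whose terms are all defined. *)
Definition pholds_lit (S : signature) (cst : Type) (N : pstructure S cst)
    (l : literal S (F01 S) cst) : Prop :=
  exists v : 'I_(aar l.2) -> car (pbase N),
    (forall i, @peval S cst N (aargs l.2 i) (v i)) /\
    (if l.1 then irel (apr l.2) v else ~ irel (apr l.2) v).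

Definition weakly_satisfies (S : signature) (cst : Type) (N : pstructure S cst)
    (C : clause S (F01 S) cst) : Prop :=
  (exists t, In t (lsub C) /\ ~ pdefined N t) \/
  ((forall t, In t (lsub C) -> pdefined N t) /\
   exists l, In l C /\ pholds_lit N l).

Definition st (S : signature) (cst : Type) (K : seq (clause S (F01 S) nat))
    (G : seq (clause S (F01 S) cst)) (t : term (F01 S) cst) : Prop :=
  In t (lsub (flatten G)) \/
  exists u, [/\ In u (lsub (flatten K)),
                forall x, ~ leaf_in x (subterms u)
              & forall s : nat -> term (F01 S) cst, t = bind s u].

(* K[G].  Its clauses are ground: [s] instantiates every variable. *)
Definition Kinst (S : signature) (cst : Type) (K : seq (clause S (F01 S) nat))
    (G : seq (clause S (F01 S) cst)) (C : clause S (F01 S) cst) : Prop :=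
  (exists C0 (s : nat -> term (F01 S) cst), In C0 K /\ C = cbind s C0) /\
  forall t, In t (lsub C) -> ext_headed t -> st K G t.

Definition local_extension (S : signature) (cst : Type)
    (T0 : theory S (F0 S)) (K : seq (clause S (F01 S) nat)) : Prop :=
  forall G : seq (clause S (F01 S) cst),
    unsat_clauses (extension T0 K) G <->
    ~ exists N : pstructure S cst,
        [/\ T0 (pbase N),
            forall t, st K G t -> pdefined N t
          & forall C, Kinst K G C \/ In C G -> weakly_satisfies N C].

(* The terms s_i: one of the y_j, or f_i(z_1,...,z_k) with k >= 1 and every z
   among the y_j. *)
Inductive sarg (S : signature) (n : nat) : Type :=
| SVar (j : 'I_n)
| SApp (k : nat) (f : F1 S k.+1) (z : 'I_k.+1 -> 'I_n).

Record combination (S : signature) : Type := Combination {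
  cn : nat;
  cf : F1 S cn;
  cg : F1 S cn;
  cRs : 'I_cn -> Pr S 2;
  cR : Pr S 2;
  cs : 'I_cn -> sarg S cn }.
Arguments cRs {S} c i.
Arguments cs {S} c i.

(* The variables x_1,...,x_n are 0,...,n-1 and y_1,...,y_n are n,...,2n-1. *)
Definition xvar (S : signature) (n : nat) (i : 'I_n) : term (F01 S) nat :=
  Leaf (val i).
Definition yvar (S : signature) (n : nat) (i : 'I_n) : term (F01 S) nat :=
  Leaf (n + val i).

Definition sterm (S : signature) (n : nat) (s : sarg S n) : term (F01 S) nat :=
  match s with
  | SVar j => yvar S j
  | SApp k f z => App (inr f : F01 S k.+1) (fun i => yvar S (z i))
  end.

Definition clause_fg (S : signature) (k : combination S) :
    clause S (F01 S) nat :=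
  horn_form
    [seq atom2 (cRs k i) (xvar S i) (sterm (cs k i)) | i <- enum 'I_(cn k)]
    (atom2 (cR k) (App (inr (cf k) : F01 S (cn k)) (@xvar S (cn k)))
                  (App (inr (cg k) : F01 S (cn k)) (@yvar S (cn k)))).

Definition clause_ff (S : signature) (k : combination S) :
    clause S (F01 S) nat :=
  horn_form
    [seq atom2 (cRs k i) (xvar S i) (yvar S i) | i <- enum 'I_(cn k)]
    (atom2 (cR k) (App (inr (cf k) : F01 S (cn k)) (@xvar S (cn k)))
                  (App (inr (cf k) : F01 S (cn k)) (@yvar S (cn k)))).

Definition of_combinations (S : signature) (T0 : theory S (F0 S))
    (P : Pr S 2 -> Prop) (K : seq (clause S (F01 S) nat)) : Prop :=
  exists ks : seq (combination S),
    (forall C, In C K <->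
       exists k, In k ks /\ (C = clause_fg k \/ C = clause_ff k)) /\
    forall k, In k ks ->
      [/\ 0 < cn k, forall i, P (cRs k i) & transitive_rel T0 (cR k)].

Definition same_clause (S : signature) (K : seq (clause S (F01 S) nat))
    (f g : {n : nat & F1 S n}) : Prop :=
  exists C, [/\ In C K, ext_in (tagged f) (lsub C) & ext_in (tagged g) (lsub C)].

Definition sim (S : signature) (K : seq (clause S (F01 S) nat)) :
    {n : nat & F1 S n} -> {n : nat & F1 S n} -> Prop :=
  clos_refl_sym_trans _ (same_clause K).

Definition common_ext (S : signature) (cst : Type)
    (K : seq (clause S (F01 S) nat)) (A B : seq (literal S (F01 S) cst))
    (f : {n : nat & F1 S n}) : Prop :=
  exists g h, [/\ sim K f g, sim K f h,
                  ext_in (tagged g) (lsub A) & ext_in (tagged h) (lsub B)].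

Definition common_cst (S : signature) (cst : Type)
    (A B : seq (literal S (F01 S) cst)) (c : cst) : Prop :=
  leaf_in c (lsub A) /\ leaf_in c (lsub B).

(* All constants and extension functions in the list [ts] are common. *)
Definition common_symbols (S : signature) (cst : Type)
    (K : seq (clause S (F01 S) nat)) (A B : seq (literal S (F01 S) cst))
    (ts : seq (term (F01 S) cst)) : Prop :=
  (forall c, leaf_in c ts -> common_cst A B c) /\
  (forall n (f : F1 S n), ext_in f ts -> common_ext K A B (existT _ n f)).

Definition interpolant (S : signature) (cst : Type) (T0 : theory S (F0 S))
    (K : seq (clause S (F01 S) nat)) (A B : seq (literal S (F01 S) cst))
    (I : formula S (F01 S) cst) : Prop :=
  [/\ common_symbols K A B (fsub I),
      forall M, extension T0 K M -> forall v : cst -> car M,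
        holds_all v A -> holds v I
    & forall M, extension T0 K M -> forall v : cst -> car M,
        ~ (holds v I /\ holds_all v B)].

(* The definition f(c_1,...,c_n) = c. *)
Record defn (S : signature) (cst : Type) : Type := Defn {
  dn : nat;
  df : F1 S dn;
  dargs : 'I_dn -> cst;
  dval : cst }.
Arguments Defn {S cst dn} df dargs dval.
Arguments dargs {S cst} d i.

Definition defn_clause (S : signature) (cst : Type) (d : defn S cst) :
    clause S (F01 S) cst :=
  [:: (true, atom2 (peq S)
       (App (inr (df d) : F01 S (dn d)) (fun i => Leaf (dargs d i)))
       (Leaf (dval d)))].

Definition is_leaf F X (t : term F X) : bool :=
  if t is Leaf _ then true else false.

(* The subterms of [L] that get a name: the terms starting with an extension
   function, and the arguments of extension functions that are not constants. *)
Definition named (S : signature) (cst : Type) (L : seq (literal S (F01 S) cst)) :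
    seq (term (F01 S) cst) :=
  flatten [seq match t with
               | App n (inr _) a =>
                   t :: [seq u <- [seq a i | i <- enum 'I_n] | ~~ is_leaf u]
               | _ => [::]
               end | t <- lsub L].

(* [nm t] is the constant c_t; the values of [nm] outside the named subterms of
   [A] and [B] are never used. *)
Definition naming (S : signature) (cst : Type)
    (A B : seq (literal S (F01 S) cst)) (nm : term (F01 S) cst -> cst) : Prop :=
  (forall t, In t (named (A ++ B)) -> ~ leaf_in (nm t) (lsub (A ++ B))) /\
  (forall t u, In t (named (A ++ B)) -> In u (named (A ++ B)) ->
     nm t = nm u -> t = u).

Fixpoint pur (S : signature) (cst : Type) (nm : term (F01 S) cst -> cst)
    (t : term (F01 S) cst) : term (F0 S) cst :=
  match t with
  | Leaf c => Leaf c
  | App n (inl f) a => App f (fun i => pur nm (a i))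
  | App n (inr _) _ => Leaf (nm t)
  end.

Definition pur_lit (S : signature) (cst : Type) (nm : term (F01 S) cst -> cst)
    (l : literal S (F01 S) cst) : literal S (F0 S) cst :=
  (l.1, Atom (apr l.2) (fun i => pur nm (aargs l.2 i))).

(* A_0 for [L] = A: the purified literals, together with c_t = t for the base
   terms t that are arguments of extension functions. *)
Definition pur_lits (S : signature) (cst : Type) (nm : term (F01 S) cst -> cst)
    (L : seq (literal S (F01 S) cst)) : seq (literal S (F0 S) cst) :=
  [seq pur_lit nm l | l <- L] ++
  flatten [seq match t with
               | App n (inr _) a =>
                   flatten [seq match a i with
                                | App _ (inl _) _ =>
                                    [:: (true, atom2 (peq S)
                                           (Leaf (nm (a i))) (pur nm (a i)))]
                                | _ => [::]
                                end | i <- enum 'I_n]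
               | _ => [::]
               end | t <- lsub L].

Definition arg_cst (S : signature) (cst : Type) (nm : term (F01 S) cst -> cst)
    (t : term (F01 S) cst) : cst :=
  if t is Leaf c then c else nm t.

(* D_A for [L] = A. *)
Definition pur_defs (S : signature) (cst : Type) (nm : term (F01 S) cst -> cst)
    (L : seq (literal S (F01 S) cst)) : seq (defn S cst) :=
  flatten [seq match t with
               | App n (inr f) a =>
                   [:: Defn f (fun i => arg_cst nm (a i)) (nm t)]
               | _ => [::]
               end | t <- lsub L].

(* The clause /\_i c_i R_i d_i -> c R d, together with the function symbol f for
   which c = f(c_1,...,c_n) is among the definitions. *)
Record horn (S : signature) (cst : Type) : Type := Horn {
  hn : nat;
  hf : F1 S hn;
  hRs : 'I_hn -> Pr S 2;
  hc : 'I_hn -> cst;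
  hd : 'I_hn -> cst;
  hR : Pr S 2;
  hcc : cst;
  hdd : cst }.
Arguments hRs {S cst} h i.
Arguments hc {S cst} h i.
Arguments hd {S cst} h i.

Definition prem (S : signature) (cst : Type) (C : horn S cst) :
    seq (atom S (F0 S) cst) :=
  [seq atom2 (hRs C i) (Leaf (hc C i)) (Leaf (hd C i)) | i <- enum 'I_(hn C)].

Definition concl (S : signature) (cst : Type) (C : horn S cst) :
    atom S (F0 S) cst :=
  atom2 (hR C) (Leaf (hcc C)) (Leaf (hdd C)).

Definition horn_clause (S : signature) (cst : Type) (C : horn S cst) :
    clause S (F0 S) cst :=
  horn_form (prem C) (concl C).

(* [abstracts D t u]: [u] is [t] with the terms starting with an extension
   function replaced by the constants that [D] defines for them. *)
Inductive abstracts (S : signature) (cst : Type) (D : seq (defn S cst)) :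
    term (F01 S) cst -> term (F0 S) cst -> Prop :=
| AbsLeaf c : abstracts D (Leaf c) (Leaf c)
| AbsBase n (f : F0 S n) a b :
    (forall i, abstracts D (a i) (b i)) ->
    abstracts D (App (inl f : F01 S n) a) (App f b)
| AbsExt n (f : F1 S n) (c : 'I_n -> cst) (d : cst) :
    In (Defn f c d) D ->
    abstracts D (App (inr f : F01 S n) (fun i => Leaf (c i))) (Leaf d).

Inductive abstracts_lit (S : signature) (cst : Type) (D : seq (defn S cst)) :
    literal S (F01 S) cst -> literal S (F0 S) cst -> Prop :=
| AbsLit (b : bool) n (p : Pr S n) a a' :
    (forall i, abstracts D (a i) (a' i)) ->
    abstracts_lit D (b, Atom p a) (b, Atom p a').

(* Clauses of K_0, obtained from K[D] by replacing the extension terms. *)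
Definition in_K0 (S : signature) (cst : Type) (K : seq (clause S (F01 S) nat))
    (D : seq (defn S cst)) (C : horn S cst) : Prop :=
  In (Defn (hf C) (hc C) (hcc C)) D /\
  exists C', Kinst K [seq defn_clause d | d <- D] C' /\
             List.Forall2 (abstracts_lit D) C' (horn_clause C).

(* Clauses of Con[D]_0. *)
Definition in_Con0 (S : signature) (cst : Type) (D : seq (defn S cst))
    (C : horn S cst) : Prop :=
  [/\ In (Defn (hf C) (hc C) (hcc C)) D,
      In (Defn (hf C) (hd C) (hdd C)) D,
      forall i, hRs C i = peq S
    & hR C = peq S].

(* [com]: the constants considered common.  [den]: the introduced constants with
   the terms they denote, latest first. *)
Record rstate (S : signature) (cst : Type) : Type := RState {
  com : cst -> Prop;
  den : seq (cst * term (F01 S) cst);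
  Hcur : seq (horn S cst);
  Hsep : seq (clause S (F0 S) cst);
  Delta : seq (atom S (F0 S) cst) }.

Inductive config (S : signature) (cst : Type) : Type :=
| Start
| Reduce (nm : term (F01 S) cst -> cst) (s : rstate S cst)
| Interpolated (dn : seq (cst * term (F01 S) cst)) (I0 : formula S (F0 S) cst)
| Done (I : formula S (F01 S) cst).
Arguments Start {S cst}.
Arguments Interpolated {S cst} dn I0.

(* Initially common: the constants occurring in both [A] and [B], and the
   constants naming terms built from common symbols, even if such a term occurs
   on one side only. *)
Definition com_init (S : signature) (cst : Type)
    (K : seq (clause S (F01 S) nat)) (A B : seq (literal S (F01 S) cst))
    (nm : term (F01 S) cst -> cst) (c : cst) : Prop :=
  common_cst A B c \/
  exists t, [/\ In t (named (A ++ B)), c = nm t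
              & common_symbols K A B (subterms t)].

(* The constants of one side, [L] being A or B. *)
Definition side (S : signature) (cst : Type) (nm : term (F01 S) cst -> cst)
    (L : seq (literal S (F01 S) cst)) (s : rstate S cst) (c : cst) : Prop :=
  [\/ leaf_in c (lsub (pur_lits nm L)),
      leaf_in c (lsub (flatten [seq defn_clause d | d <- pur_defs nm L]))
    | com s c].

Definition across (S : signature) (cst : Type) (p q : cst -> Prop)
    (C : horn S cst) : Prop :=
  [/\ forall i, p (hc C i), p (hcc C),
      forall i, q (hd C i) & q (hdd C)].

Definition mixed (S : signature) (cst : Type) (nm : term (F01 S) cst -> cst)
    (A B : seq (literal S (F01 S) cst)) (s : rstate S cst) (C : horn S cst) :
    Prop :=
  across (side nm A s) (side nm B s) C \/ across (side nm B s) (side nm A s) C.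

(* A_0 /\ B_0 /\ Delta *)
Definition facts (S : signature) (cst : Type) (nm : term (F01 S) cst -> cst)
    (A B : seq (literal S (F01 S) cst)) (s : rstate S cst) :
    seq (literal S (F0 S) cst) :=
  pur_lits nm A ++ pur_lits nm B ++ [seq (true, p) | p <- Delta s].

Definition enabled (S : signature) (cst : Type) (T0 : theory S (F0 S))
    (nm : term (F01 S) cst -> cst) (A B : seq (literal S (F01 S) cst))
    (s : rstate S cst) (C : horn S cst) : Prop :=
  forall p, In p (prem C) -> entails_atom T0 (facts nm A B s) p.

(* C is a clause of (H \ H_mix) /\ H_sep. *)
Definition in_separated (S : signature) (cst : Type)
    (nm : term (F01 S) cst -> cst) (A B : seq (literal S (F01 S) cst))
    (s : rstate S cst) (C : clause S (F0 S) cst) : Prop :=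
  (exists h, [/\ In h (Hcur s), ~ mixed nm A B s h & C = horn_clause h]) \/
  In C (Hsep s).

(* The part for the side [L] (A or B) of
   A_0 /\ B_0 /\ (H \ H_mix) /\ H_sep.  It contains the clauses themselves and
   not only their conclusions: the premise of a clause over A-constants may follow
   from A_0 and B_0 jointly, in which case A does not entail the conclusion. *)
Definition separated_part (S : signature) (cst : Type)
    (nm : term (F01 S) cst -> cst) (A B : seq (literal S (F01 S) cst))
    (s : rstate S cst) (L : seq (literal S (F01 S) cst))
    (C : clause S (F0 S) cst) : Prop :=
  (exists l, In l (pur_lits nm L) /\ C = [:: l]) \/
  (in_separated nm A B s C /\ forall c, leaf_in c (lsub C) -> side nm L s c).

(* The constants in [dn] are replaced one after the other, starting with the one
   introduced last, so that constants inside the terms are replaced as well. *)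
Definition expand (S : signature) (cst : eqType)
    (dn : seq (cst * term (F01 S) cst)) (I0 : formula S (F0 S) cst) :
    formula S (F01 S) cst :=
  foldl (fun I d => fbind (fun c => if c == d.1 then d.2 else Leaf c) I)
    (fembed I0) dn.

(* The separated clauses C_1 and C_2 of [C], for separating terms [t] and the
   constant [c] denoting f(t_1,...,t_n). *)
Definition sep_clause1 (S : signature) (cst : Type) (C : horn S cst)
    (t : 'I_(hn C) -> term (F0 S) cst) (c : cst) : clause S (F0 S) cst :=
  horn_form [seq atom2 (hRs C i) (Leaf (hc C i)) (t i) | i <- enum 'I_(hn C)]
    (atom2 (hR C) (Leaf (hcc C)) (Leaf c)).

Definition sep_clause2 (S : signature) (cst : Type) (C : horn S cst)
    (t : 'I_(hn C) -> term (F0 S) cst) (c : cst) : clause S (F0 S) cst :=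
  horn_form [seq atom2 (hRs C i) (t i) (Leaf (hd C i)) | i <- enum 'I_(hn C)]
    (atom2 (hR C) (Leaf c) (Leaf (hdd C))).

(* All choices (names, order of the clauses, separating terms, interpolant of
   the base problem) are left open. *)
Inductive step (S : signature) (cst : eqType) (T0 : theory S (F0 S))
    (K : seq (clause S (F01 S) nat)) (A B : seq (literal S (F01 S) cst)) :
    config S cst -> config S cst -> Prop :=
| step_purify nm H :
    naming A B nm ->
    (forall C, In C H <->
       in_K0 K (pur_defs nm A ++ pur_defs nm B) C \/
       in_Con0 (pur_defs nm A ++ pur_defs nm B) C) ->
    step T0 K A B Start
      (Reduce nm (RState (com_init K A B nm)
                    [seq (nm t, t) | t <- named (A ++ B)] H [::] [::]))
| step_separate nm s H1 C H2 (t : 'I_(hn C) -> term (F0 S) cst) (c : cst) :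
    Hcur s = H1 ++ C :: H2 ->
    enabled T0 nm A B s C ->
    mixed nm A B s C ->
    (forall i x, leaf_in x (subterms (t i)) -> com s x) ->
    (forall i,
       entails_atom T0 (facts nm A B s) (atom2 (hRs C i) (Leaf (hc C i)) (t i)) /\
       entails_atom T0 (facts nm A B s) (atom2 (hRs C i) (t i) (Leaf (hd C i)))) ->
    ~ leaf_in c (lsub (A ++ B)) ->
    c \notin [seq d.1 | d <- den s] ->
    step T0 K A B (Reduce nm s)
      (Reduce nm
         (RState (fun x => com s x \/ x = c)
            ((c, App (inr (hf C) : F01 S (hn C)) (fun i => embed (t i))) :: den s)
            (H1 ++ H2)
            (sep_clause1 t c :: sep_clause2 t c :: Hsep s)
            (atom2 (hR C) (Leaf (hcc C)) (Leaf c) ::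
             atom2 (hR C) (Leaf c) (Leaf (hdd C)) :: Delta s)))
| step_move nm s H1 C H2 :
    Hcur s = H1 ++ C :: H2 ->
    enabled T0 nm A B s C ->
    ~ mixed nm A B s C ->
    step T0 K A B (Reduce nm s)
      (Reduce nm
         (RState (com s) (den s) (H1 ++ H2) (horn_clause C :: Hsep s)
            (concl C :: Delta s)))
| step_interpolate nm s Abar Bbar I0 :
    (forall C, In C (Hcur s) -> ~ enabled T0 nm A B s C) ->
    (forall C, In C Abar <-> separated_part nm A B s A C) ->
    (forall C, In C Bbar <-> separated_part nm A B s B C) ->
    interpolant0 T0 Abar Bbar I0 ->
    step T0 K A B (Reduce nm s) (Interpolated (den s) I0)
| step_expand dn I0 :
    step T0 K A B (Interpolated dn I0) (Done (expand dn I0)).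

(* Every run from [Start] is finite. *)
Definition terminates (S : signature) (cst : eqType) (T0 : theory S (F0 S))
    (K : seq (clause S (F01 S) nat)) (A B : seq (literal S (F01 S) cst)) : Prop :=
  Acc (fun s' s => step T0 K A B s s') Start.

(* No run gets stuck before [Done], and every run that reaches [Done] ends with
   an interpolant. *)
Definition computes_interpolant (S : signature) (cst : eqType)
    (T0 : theory S (F0 S)) (K : seq (clause S (F01 S) nat))
    (A B : seq (literal S (F01 S) cst)) : Prop :=
  forall s, clos_refl_trans _ (step T0 K A B) Start s ->
    ~ (exists s', step T0 K A B s s') ->
    exists I, s = Done I /\ interpolant T0 K A B I.

(* Main.v *)
Require Import Defs.
From Stdlib Require Import Eqdep_dec PeanoNat Classical ClassicalEpsilon.
From Stdlib Require Import FunctionalExtensionality Relation_Operators.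
From mathcomp Require Import all_boot.

(* Each constant c_t denotes a term over A and B, and expanding an interpolant I_0
   of the base problem evaluates I_0 at these denotations.  In a model of T_1 all
   clauses of H and all separated clauses hold under the denotations, because the
   separated clauses are instances of the two clause schemes of K at f(t_1,...,t_n);
   so the expansion is an interpolant as soon as I_0 is one.  Its symbols are common
   since a constant lies on both sides only if it denotes a common term, and the
   function f of a mixed clause is common by ~.

   The base problem is unsatisfiable when no clause is enabled any more: every
   remaining clause has a premise not entailed by A_0, B_0 and Delta, and convexity
   gives one model of these facts refuting all such premises at once.  All of H
   holds there (for separated clauses by transitivity of R), so reading the
   definitions as a finite table for the extension functions yields a partial
   structure, which locality excludes. *)

Set Implicit Arguments.
Unset Strict Implicit.
Unset Printing Implicit Defensive.

(** The delicate point is which constants each side may use. [P_interpolating] returns terms over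
    the constants shared by two given conjunctions, so A_0, B_0 and Delta have to be split into two
    one-sided conjunctions. This works because every clause of H is either mixed or over one side,
    and separation replaces a mixed clause by two one-sided ones. The critical case is a premise
    constant d_i naming a term f_i(z) that occurs only on the side opposite to g: its name must
    count as common, which is why [com_init] admits names of terms occurring on one side only. The
    two schemes of K work together: C_1 compares f with f and C_2 compares f with g. Equality has to
    be in P because the premises of Con_0 are equations, and these are separated as well. Arities at
    least 1 leave K without ground terms, so only the definitions contribute extension terms to
    K[D]. Infinitely many constants supply the names. Termination holds because every reduction step
    takes a clause out of H and returns none. *)

(** * Lists, finite enumerations and dependent equality *)

Lemma In_mem (T : eqType) (x : T) l : In x l <-> x \in l.
Proof.
elim: l => [|y l IH] //=; rewrite inE; split.
  by case=> [->|/IH ->]; rewrite ?eqxx ?orbT.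
by case/predU1P=> [->|/IH]; [left|right].
Qed.

Lemma In_enum (T : finType) (x : T) : In x (enum T).
Proof. by apply/In_mem; rewrite mem_enum. Qed.

Lemma In_cat T (x : T) l1 l2 : In x (l1 ++ l2) <-> In x l1 \/ In x l2.
Proof. exact: List.in_app_iff. Qed.

Lemma In_map T U (f : T -> U) y l : In y [seq f x | x <- l] <-> exists x, In x l /\ y = f x.
Proof.
elim: l => [|a l IH] /=; first by split=> [//|[x []]].
rewrite IH; split.
  by case=> [<-|[x [xl ->]]]; [exists a; split; [left|]|exists x; split; [right|]].
by case=> x [[->|xl] ->]; [left|right; exists x].
Qed.

Lemma In_flatten T U (f : T -> seq U) y l :
  In y (flatten [seq f x | x <- l]) <-> exists x, In x l /\ In y (f x).
Proof.
elim: l => [|a l IH] /=; first by split=> [//|[x []]].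
rewrite In_cat IH; split.
  by case=> [yf|[x [xl yf]]]; [exists a; split; [left|]|exists x; split; [right|]].
by case=> x [[->|xl] yf]; [left|right; exists x].
Qed.

Lemma In_filter T (p : pred T) x l : In x [seq y <- l | p y] <-> In x l /\ p x.
Proof.
elim: l => [|a l IH] /=; first by split=> [//|[]].
case: ifP => pa /=; rewrite IH; split.
- by case=> [<-|[xl px]]; [split; [left|]|split; [right|]].
- by case=> [[->|xl] px]; [left|right].
- by case=> xl px; split; [right|].
- by case=> [[eax|xl] px]; [rewrite -eax pa in px|].
Qed.

Lemma ex_filter T (P : T -> Prop) l : exists l', forall x, In x l' <-> In x l /\ P x.
Proof.
exists [seq x <- l | if excluded_middle_informative (P x) then true else false] => x.
by rewrite In_filter; case: excluded_middle_informative => px; split=> -[].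
Qed.

Lemma ex_sublist T (P : T -> Prop) l :
  (forall x, P x -> In x l) -> exists l', forall x, In x l' <-> P x.
Proof.
move=> Pl; have [l' l'P] := ex_filter P l; exists l' => x; rewrite l'P.
by split=> [[]|px] //; split=> //; apply: Pl.
Qed.

(** [T] need not have decidable equality, so a function is encoded by the positions of its values in
    [l]; these codes form a finite type. *)
Definition funs n T (l : seq T) : seq ('I_n -> T) :=
  [seq (fun i => tnth (in_tuple l) (g i))
     | g : {ffun 'I_n -> 'I_(size l)} <- enum {ffun 'I_n -> 'I_(size l)}].

Lemma In_tnth T (x : T) l : In x l -> exists i, x = tnth (in_tuple l) i.
Proof.
move=> xl; have [i [il <-]] : exists i, i < size l /\ nth x l i = x.
  elim: l xl => [|a l IH] //= [->|/IH [i [il e]]]; first by exists 0.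
  by exists i.+1.
by exists (Ordinal il); rewrite (tnth_nth x).
Qed.

Lemma In_funs n T (l : seq T) (f : 'I_n -> T) :
  (forall i, In (f i) l) -> In f (funs n l).
Proof.
move=> fl.
have fP i : {j | f i = tnth (in_tuple l) j}.
  exact: constructive_indefinite_description (In_tnth (fl i)).
apply/In_map; exists [ffun i => proj1_sig (fP i)]; split; first exact: In_enum.
by apply: functional_extensionality => i; rewrite ffunE; case: (fP i).
Qed.

Lemma Forall2_map_enum n T U (R : T -> U -> Prop) (F : 'I_n -> T) (G : 'I_n -> U) :
  List.Forall2 R [seq F i | i <- enum 'I_n] [seq G i | i <- enum 'I_n] <->
  forall i, R (F i) (G i).
Proof.
split=> [FG i|FG]; last by elim: (enum _) => [|i l IH] /=; constructor.
have := In_enum i; elim: (enum _) FG => [|j l IH] //= FG.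
by inversion FG; subst=> -[<- //|]; apply: IH.
Qed.

Lemma Forall2_rcons T U (R : T -> U -> Prop) s1 s2 x y :
  List.Forall2 R (s1 ++ [:: x]) (s2 ++ [:: y]) -> List.Forall2 R s1 s2 /\ R x y.
Proof.
elim: s1 s2 => [|a s1 IH] [|b s2] //= H; inversion H as [|? ? ? ? ab H']; subst.
- by split.
- by case: s2 H H' => [|? ?] _ H'; inversion H'.
- by case: s1 IH H H' => [|? ?] _ _ H'; inversion H'.
- by have [? ?] := IH _ H'; split=> //; constructor.
Qed.

Lemma Forall2_size T U (R : T -> U -> Prop) s1 s2 :
  List.Forall2 R s1 s2 -> size s1 = size s2.
Proof. exact: List.Forall2_length. Qed.

(** Symbols are indexed by their arity, so inversion yields equalities of dependent pairs;
    decidability of equality on [nat] makes their second components equal. *)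
Ltac inj_deps :=
  repeat match goal with
  | H : existT _ _ _ = existT _ _ _ |- _ =>
      apply (inj_pair2_eq_dec _ Nat.eq_dec) in H
  end.

(** * Terms and substitutions *)

Section Terms.
Variables (S : signature) (F : nat -> Type).

Lemma ord2P (P : 'I_2 -> Prop) : P ord0 -> P ord_max -> forall i, P i.
Proof.
move=> P0 P1 [[|[|//]] i2].
  by rewrite (_ : Ordinal i2 = ord0) //; apply: val_inj.
by rewrite (_ : Ordinal i2 = ord_max) //; apply: val_inj.
Qed.

Lemma comp_pair2 T U (h : T -> U) x y :
  (fun i => h (pair2 x y i)) = pair2 (h x) (h y).
Proof. by apply: functional_extensionality; apply: ord2P. Qed.

Lemma In_subterms_App X (u : term F X) n (f : F n) a :
  In u (subterms (App f a)) <-> u = App f a \/ exists i, In u (subterms (a i)).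
Proof.
rewrite /= In_flatten; split.
  by case=> [<-|[i [_ ui]]]; [left|right; exists i].
by case=> [->|[i ui]]; [left|right; exists i; split; first exact: In_enum].
Qed.

Lemma subterms_refl X (t : term F X) : In t (subterms t).
Proof. by case: t => *; left. Qed.

Lemma subterms_trans X (u t w : term F X) :
  In u (subterms t) -> In t (subterms w) -> In u (subterms w).
Proof.
move=> ut; elim: w => [x|n f a IH]; first by case=> // ->.
case/In_subterms_App=> [<- //|[i ti]].
by apply/In_subterms_App; right; exists i; apply: IH.
Qed.

Lemma In_asub X (u : term F X) (p : atom S F X) :
  In u (asub p) <-> exists i, In u (subterms (aargs p i)).
Proof.
rewrite /asub In_flatten; split=> [[i [_ ui]]|[i ui]]; exists i => //.
by split; first exact: In_enum.
Qed.

Lemma In_asub2 X (u : term F X) (R : Pr S 2) t1 t2 :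
  In u (asub (atom2 R t1 t2)) <-> In u (subterms t1) \/ In u (subterms t2).
Proof.
rewrite In_asub; split=> [[]|[]].
- by apply: ord2P; [left|right].
- by exists ord0.
- by exists ord_max.
Qed.

Lemma In_lsub X (u : term F X) (L : seq (literal S F X)) :
  In u (lsub L) <-> exists l, In l L /\ In u (asub l.2).
Proof. exact: In_flatten. Qed.

Lemma In_lsub_cat X (u : term F X) (L1 L2 : seq (literal S F X)) :
  In u (lsub (L1 ++ L2)) <-> In u (lsub L1) \/ In u (lsub L2).
Proof. by rewrite /lsub map_cat flatten_cat In_cat. Qed.

Lemma lsub_trans X (u t : term F X) (L : seq (literal S F X)) :
  In u (subterms t) -> In t (lsub L) -> In u (lsub L).
Proof.
move=> ut /In_lsub [l [lL /In_asub [i ti]]]; apply/In_lsub; exists l; split=> //.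
by apply/In_asub; exists i; apply: subterms_trans ti.
Qed.

Lemma In_lsub_horn X (u : term F X) (ps : seq (atom S F X)) q :
  In u (lsub (horn_form ps q)) <->
  In u (asub q) \/ exists p, In p ps /\ In u (asub p).
Proof.
rewrite In_lsub /horn_form; split.
  case=> l [/In_cat [/In_map [p [pps ->]] up|[<-|//] uq]]; last by left.
  by right; exists p.
case=> [uq|[p [pps up]]].
  by exists (true, q); split=> //; apply/In_cat; right; left.
by exists (false, p); split=> //; apply/In_cat; left; apply/In_map; exists p.
Qed.

Lemma bind_bind X Y Z (s : Y -> term F Z) (r : X -> term F Y) t :
  bind s (bind r t) = bind (fun x => bind s (r x)) t.
Proof.
by elim: t => //= n f a IH; congr App; apply: functional_extensionality => i.
Qed.

Lemma bind_Leaf X (t : term F X) : bind (fun x => Leaf x) t = t.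
Proof.
by elim: t => //= n f a IH; congr App; apply: functional_extensionality => i.
Qed.

Lemma abind_abind X Y Z (s : Y -> term F Z) (r : X -> term F Y) (p : atom S F X) :
  abind s (abind r p) = abind (fun x => bind s (r x)) p.
Proof.
by rewrite /abind /=; congr Atom; apply: functional_extensionality => i; apply: bind_bind.
Qed.

Lemma fbind_fbind X Y Z (s : Y -> term F Z) (r : X -> term F Y) (p : formula S F X) :
  fbind s (fbind r p) = fbind (fun x => bind s (r x)) p.
Proof.
by elim: p => //= [p|p ->|p -> q ->|p -> q ->] //; rewrite abind_abind.
Qed.

Lemma fbind_Leaf X (p : formula S F X) : fbind (fun x => Leaf x) p = p.
Proof.
elim: p => //= [p|p ->|p -> q ->|p -> q ->] //; congr FAtom.
by case: p => n R a; congr Atom; apply: functional_extensionality => i; apply: bind_Leaf.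
Qed.

Lemma bind_eq_in X Y (s r : X -> term F Y) t :
  (forall x, leaf_in x (subterms t) -> s x = r x) -> bind s t = bind r t.
Proof.
elim: t => [x|n f a IH] sr /=; first by apply: sr; left.
congr App; apply: functional_extensionality => i; apply: IH => x xi.
by apply: sr; apply/In_subterms_App; right; exists i.
Qed.

Lemma In_subterms_bind X Y (s : X -> term F Y) u t :
  In u (subterms (bind s t)) ->
  (exists x, leaf_in x (subterms t) /\ In u (subterms (s x))) \/
  exists n (f : F n) a, In (App f a) (subterms t) /\ u = App f (fun i => bind s (a i)).
Proof.
elim: t => [x|n f a IH]; first by move=> us; left; exists x; split; first by left.
case/In_subterms_App=> [->|[i /IH [[x [xa us]]|[m [g [b [ga ->]]]]]]].
- by right; exists n, f, a; split; first by left.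
- by left; exists x; split=> //; apply/In_subterms_App; right; exists i.
- by right; exists m, g, b; split=> //; apply/In_subterms_App; right; exists i.
Qed.

Lemma In_fsub_fbind X Y (s : X -> term F Y) u (p : formula S F X) :
  In u (fsub (fbind s p)) -> exists t, In t (fsub p) /\ In u (subterms (bind s t)).
Proof.
elim: p => //=.
- move=> p /In_asub [i ui]; exists (aargs p i); split=> //.
  by apply/In_asub; exists i; apply: subterms_refl.
- move=> p IHp q IHq /In_cat [/IHp|/IHq] [t [tp ut]]; exists t; split=> //;
    by apply/In_cat; auto.
- move=> p IHp q IHq /In_cat [/IHp|/IHq] [t [tp ut]]; exists t; split=> //;
    by apply/In_cat; auto.
Qed.

Lemma fsub_trans X (u t : term F X) (p : formula S F X) :
  In u (subterms t) -> In t (fsub p) -> In u (fsub p).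
Proof.
move=> ut; elim: p => //=.
- move=> p /In_asub [i ti]; apply/In_asub; exists i; exact: subterms_trans ti.
- by move=> p IHp q IHq /In_cat [/IHp|/IHq] up; apply/In_cat; auto.
- by move=> p IHp q IHq /In_cat [/IHp|/IHq] up; apply/In_cat; auto.
Qed.

Variable M : structure S F.

Lemma eval_bind X Y (s : X -> term F Y) (v : Y -> car M) t :
  eval v (bind s t) = eval (fun x => eval v (s x)) t.
Proof.
by elim: t => //= n f a IH; congr ifun; apply: functional_extensionality => i.
Qed.

Lemma eval_eq_in X (v w : X -> car M) t :
  (forall x, leaf_in x (subterms t) -> v x = w x) -> eval v t = eval w t.
Proof.
elim: t => [x|n f a IH] vw /=; first by apply: vw; left.
congr ifun; apply: functional_extensionality => i; apply: IH => x xi.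
by apply: vw; apply/In_subterms_App; right; exists i.
Qed.

Lemma holds_fbind X Y (s : X -> term F Y) (v : Y -> car M) (p : formula S F X) :
  holds v (fbind s p) <-> holds (fun x => eval v (s x)) p.
Proof.
elim: p => [||p|p IHp|p IHp q IHq|p IHp q IHq] /=; try tauto.
rewrite /holds_atom /= (_ : (fun i => _) = (fun i => eval (fun x => eval v (s x)) (aargs p
  i))) //.
by apply: functional_extensionality => i; apply: eval_bind.
Qed.

Lemma holds_atom2 X (v : X -> car M) R t1 t2 :
  holds_atom v (atom2 R t1 t2) <-> irel R (pair2 (eval v t1) (eval v t2)).
Proof. by rewrite /holds_atom /= comp_pair2. Qed.

Lemma holds_horn X (v : X -> car M) ps q :
  holds_clause v (horn_form ps q) <->
  ((forall p, In p ps -> holds_atom v p) -> holds_atom v q).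
Proof.
split=> [[l [/In_cat lps lv]] vps|psq].
  case: lps lv => [/In_map [p [pps ->]] lv|[<-|//] //].
  by case: lv; apply: vps.
have [/psq vq|] := classic (forall p, In p ps -> holds_atom v p).
  by exists (true, q); split=> //; apply/In_cat; right; left.
move=> /not_all_ex_not [p np]; case: (imply_to_and _ _ np) => pps vp.
by exists (false, p); split=> //; apply/In_cat; left; apply/In_map; exists p.
Qed.

(** This preserves the truth of older clauses when a fresh constant receives a denotation. *)
Lemma holds_clause_eq_in X (v w : X -> car M) (C : clause S F X) :
  (forall x, leaf_in x (lsub C) -> v x = w x) -> holds_clause v C -> holds_clause w C.
Proof.
move=> vw [l [lC vl]]; exists l; split=> //; move: vl.
rewrite /holds_lit /holds_atom (_ : (fun i => eval v _) = (fun i => eval w (aargs l.2 i))) //.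
apply: functional_extensionality => i; apply: eval_eq_in => x xi; apply: vw.
by apply/In_lsub; exists l; split=> //; apply/In_asub; exists i.
Qed.

Lemma holds_all_cat X (v : X -> car M) L1 L2 :
  holds_all v (L1 ++ L2) <-> holds_all v L1 /\ holds_all v L2.
Proof.
split=> [vL|[v1 v2] l /In_cat [/v1|/v2] //].
by split=> l lL; apply: vL; apply/In_cat; [left|right].
Qed.

Lemma holds_all_pos X (v : X -> car M) ps :
  holds_all v [seq (true, p) | p <- ps] <-> forall p, In p ps -> holds_atom v p.
Proof.
split=> [vps p pps|vps l /In_map [p [pps ->]]]; last exact: vps.
by apply: (vps (true, p)); apply/In_map; exists p.
Qed.

End Terms.

(** * Base terms inside the extended signature *)

Section Embedding.
Variable S : signature.

Lemma eval_embed X (M : structure S (F01 S)) (v : X -> car M) (t : term (F0 S) X) :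
  eval v (embed t) = eval (M := reduct M) v t.
Proof.
by elim: t => //= n f a IH; congr ifun; apply: functional_extensionality => i.
Qed.

Lemma holds_fembed X (M : structure S (F01 S)) (v : X -> car M) (p : formula S (F0 S) X) :
  holds v (fembed p) <-> holds (M := reduct M) v p.
Proof.
elim: p => [||p|p IHp|p IHp q IHq|p IHp q IHq] /=; try tauto.
rewrite /holds_atom /=.
rewrite (_ : (fun i => _) = (fun i => eval (M := reduct M) v (aargs p i))) //.
by apply: functional_extensionality => i; apply: eval_embed.
Qed.

Lemma In_subterms_embed X u (t : term (F0 S) X) :
  In u (subterms (embed t)) -> exists w, In w (subterms t) /\ u = embed w.
Proof.
elim: t => [x|n f a IH]; first by case=> // <-; exists (Leaf x); split; first by left.
case/In_subterms_App=> [->|[i /IH [w [wa ->]]]].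
  by exists (App f a); split; first exact: subterms_refl.
by exists w; split=> //; apply/In_subterms_App; right; exists i.
Qed.

Lemma embed_not_ext X (t : term (F0 S) X) n (f : F1 S n) a : embed t <> App (inr f : F01 S n) a.
Proof. by case: t => // m g b; case=> e; subst=> e _; inj_deps. Qed.

Lemma leaf_in_embed X (x : X) (t : term (F0 S) X) :
  leaf_in x (subterms (embed t)) -> leaf_in x (subterms t).
Proof. by case/In_subterms_embed=> -[y [yt [->]]|? ? ? [_]]. Qed.

Lemma ext_in_embed X n (f : F1 S n) (t : term (F0 S) X) : ~ ext_in f (subterms (embed t)).
Proof. by case=> a /In_subterms_embed [w [_ /esym /embed_not_ext]]. Qed.

Lemma In_fsub_fembed X u (p : formula S (F0 S) X) :
  In u (fsub (fembed p)) -> exists w, In w (fsub p) /\ u = embed w.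
Proof.
elim: p => //=.
- move=> p /In_asub [i /In_subterms_embed [w [wi ->]]].
  by exists w; split=> //; apply/In_asub; exists i.
- by move=> p IHp q IHq /In_cat [/IHp|/IHq] [w [wp ->]]; exists w; split=> //; apply/In_cat; auto.
- by move=> p IHp q IHq /In_cat [/IHp|/IHq] [w [wp ->]]; exists w; split=> //; apply/In_cat; auto.
Qed.

End Embedding.

(** * Replacing extension terms by the constants that define them *)

Section Abstraction.
Variables (S : signature) (cst : Type) (D : seq (defn S cst)).

Lemma abstracts_Leaf_l c u : abstracts D (Leaf c) u -> u = Leaf c.
Proof. by move=> cu; inversion cu. Qed.

Lemma abstracts_ext n (f : F1 S n) b u :
  abstracts D (App (inr f : F01 S n) b) u ->
  exists c d, [/\ b = (fun i => Leaf (c i)), u = Leaf d & In (Defn f c d) D].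
Proof.
move=> bu; inversion bu; inj_deps; subst.
by exists c0, d.
Qed.

Lemma abstracts_lit2 b b' R R' t1 t2 u1 u2 :
  abstracts_lit D (b, atom2 R t1 t2) (b', atom2 R' u1 u2) <->
  [/\ b = b', R = R', abstracts D t1 u1 & abstracts D t2 u2].
Proof.
split=> [tu|[-> -> tu1 tu2]]; last by apply: AbsLit; apply: ord2P.
inversion tu as [b0 n p a a1 aa]; inj_deps; subst.
by split=> //; [move: (aa ord0)|move: (aa ord_max)].
Qed.

Lemma In_defn_clauses (Ds : seq (defn S cst)) u :
  In u (lsub (flatten [seq defn_clause d | d <- Ds])) <->
  exists d, In d Ds /\ [\/ u = App (inr (df d) : F01 S (dn d)) (fun i => Leaf (dargs d i)),
                         exists i, u = Leaf (dargs d i) | u = Leaf (dval d)].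
Proof.
rewrite In_lsub; split.
  case=> l [/In_flatten [d [dD [<-|//]]] /In_asub2 ud]; exists d; split=> //.
  case: ud => [/In_subterms_App [->|[i [<-|//]]]|[<-|//]];
    [exact: Or31|by apply: Or32; exists i|exact: Or33].
case=> d [dD ud]; exists (true, atom2 (peq S)
       (App (inr (df d) : F01 S (dn d)) (fun i => Leaf (dargs d i)))
       (Leaf (dval d))); split.
  by apply/In_flatten; exists d; split=> //; left.
apply/In_asub2; case: ud => [->|[i ->]|->]; [left|left|right].
- exact: subterms_refl.
- by apply/In_subterms_App; right; exists i; left.
- by left.
Qed.

End Abstraction.

(** * Purification *)

Section Naming.
Variables (S : signature) (cst : Type) (nm : term (F01 S) cst -> cst).
Implicit Types L A B : seq (literal S (F01 S) cst).

Lemma In_named L t : In t (named L) <->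
  exists n (f : F1 S n) a, In (App (inr f : F01 S n) a) (lsub L) /\
    (t = App (inr f : F01 S n) a \/ ~~ is_leaf t /\ exists i, t = a i).
Proof.
rewrite /named In_flatten; split.
  case=> -[x [//]|n [f|f] a [aL]] //= [<-|/In_filter [/In_map [i [_ ->]] ai]].
    by exists n, f, a; split=> //; left.
  by exists n, f, a; split=> //; right; split=> //; exists i.
case=> n [f [a [aL ta]]]; exists (App (inr f : F01 S n) a); split=> //=.
case: ta => [->|[tl [i ta]]]; [by left|right; apply/In_filter; split=> //].
by apply/In_map; exists i; split; first exact: In_enum.
Qed.

Lemma named_lsub L t : In t (named L) -> In t (lsub L).
Proof.
case/In_named=> n [f [a [aL [->|[_ [i ->]]]]]] //; apply: lsub_trans aL.
by apply/In_subterms_App; right; exists i; apply: subterms_refl.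
Qed.

Lemma In_named_cat L1 L2 t : In t (named (L1 ++ L2)) <-> In t (named L1) \/ In t (named L2).
Proof. by rewrite /named /lsub !map_cat !flatten_cat !map_cat !flatten_cat In_cat. Qed.

Lemma In_pur_defs L d : In d (pur_defs nm L) <->
  exists n (f : F1 S n) a, In (App (inr f : F01 S n) a) (lsub L) /\
    d = Defn f (fun i => arg_cst nm (a i)) (nm (App (inr f : F01 S n) a)).
Proof.
rewrite /pur_defs In_flatten; split.
  by case=> -[x [//]|n [f|f] a [aL]] //= [<-|//]; exists n, f, a.
by case=> n [f [a [aL ->]]]; exists (App (inr f : F01 S n) a); split=> //; left.
Qed.

Lemma pur_defs_cat L1 L2 : pur_defs nm (L1 ++ L2) = pur_defs nm L1 ++ pur_defs nm L2.
Proof. by rewrite /pur_defs /lsub map_cat flatten_cat map_cat flatten_cat. Qed.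

(** Purified literals and definitions contain only such constants, so questions about the sides
    reduce to occurrences of terms in [A] and [B]. *)
Definition origin L x := leaf_in x (lsub L) \/ exists t, In t (named L) /\ x = nm t.

Lemma origin_arg L n (f : F1 S n) a i :
  In (App (inr f : F01 S n) a) (lsub L) -> origin L (arg_cst nm (a i)).
Proof.
move=> aL; case ai: (a i) => [c|m g b] /=.
  left; apply: lsub_trans aL; apply/In_subterms_App; right; exists i; rewrite ai.
  exact: subterms_refl.
right; exists (App g b); split=> //; apply/In_named; exists n, f, a; split=> //.
by right; split=> //; exists i.
Qed.

Lemma origin_ext L n (f : F1 S n) a :
  In (App (inr f : F01 S n) a) (lsub L) -> origin L (nm (App (inr f : F01 S n) a)).
Proof.
by move=> aL; right; eexists; split; last reflexivity; apply/In_named; exists n, f, a; split;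
  last left.
Qed.

Lemma origin_pur L x t :
  In t (lsub L) -> leaf_in x (subterms (pur nm t)) -> origin L x.
Proof.
elim: t => [c|n [f|f] a IH] tL /=.
- by case=> // -[<-]; left.
- case/In_subterms_App=> [//|[i xi]]; apply: (IH i) => //.
  by apply: lsub_trans tL; apply/In_subterms_App; right; exists i; apply: subterms_refl.
- by case=> // -[<-]; apply: origin_ext.
Qed.

Lemma origin_defns L x :
  leaf_in x (lsub (flatten [seq defn_clause d | d <- pur_defs nm L])) -> origin L x.
Proof.
case/In_defn_clauses=> _ [/In_pur_defs [n [f [a [aL ->]]]] /= []] //.
  by case=> i [->]; apply: origin_arg aL.
by case=> ->; apply: origin_ext.
Qed.

Lemma In_pur_lits L l : In l (pur_lits nm L) <->
  (exists2 l0, In l0 L & l = pur_lit nm l0) \/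
  exists n (f : F1 S n) a i m (g : F0 S m) b,
    [/\ In (App (inr f : F01 S n) a) (lsub L), a i = App (inl g : F01 S m) b
      & l = (true, atom2 (peq S) (Leaf (nm (a i))) (pur nm (a i)))].
Proof.
rewrite /pur_lits In_cat In_map In_flatten; split.
  case=> [[l0 [l0L ->]]|]; first by left; exists l0.
  case=> -[x [//]|n [f|f] a [aL]] //= /In_flatten [i [_]].
  case ai: (a i) => [//|m [g|//] b] [<-|//].
  by right; exists n, f, a, i, m, g, b; rewrite ai.
case=> [[l0 l0L ->]|[n [f [a [i [m [g [b [aL ai ->]]]]]]]]]; first by left; exists l0.
right; exists (App (inr f : F01 S n) a); split=> //; apply/In_flatten; exists i.
by split; [exact: In_enum|rewrite ai; left].
Qed.

Lemma origin_pur_lits L x : leaf_in x (lsub (pur_lits nm L)) -> origin L x.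
Proof.
case/In_lsub=> l [/In_pur_lits [[l0 l0L ->]|[n [f [a [i [m [g [b [aL ai ->]]]]]]]]]].
  case/In_asub=> i; apply: origin_pur; apply/In_lsub; exists l0; split=> //.
  by apply/In_asub; exists i; apply: subterms_refl.
case/In_asub2=> [[[<-]|//]|].
  by move: (origin_arg i aL); rewrite {1}ai /= ai.
apply: origin_pur; apply: lsub_trans aL.
by apply/In_subterms_App; right; exists i; apply: subterms_refl.
Qed.

Section Common.
Variables (K : seq (clause S (F01 S) nat)) (A B : seq (literal S (F01 S) cst)).
Hypothesis nmP : naming A B nm.

Lemma nm_fresh t : In t (named (A ++ B)) -> ~ leaf_in (nm t) (lsub (A ++ B)).
Proof. exact: (proj1 nmP). Qed.

Lemma nm_inj t u : In t (named (A ++ B)) -> In u (named (A ++ B)) -> nm t = nm u -> t = u.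
Proof. exact: (proj2 nmP). Qed.

Lemma named_ext n (f : F1 S n) a :
  In (App (inr f : F01 S n) a) (lsub (A ++ B)) -> In (App (inr f : F01 S n) a) (named (A ++ B)).
Proof. by move=> aL; apply/In_named; exists n, f, a; split; last left. Qed.

Definition ext_arg L t := exists n (f : F1 S n) a i, In (App (inr f : F01 S n) a) (lsub L) /\
  t = a i.

Lemma ext_arg_lsub L t : ext_arg L t -> In t (lsub L).
Proof.
case=> n [f [a [i [aL ->]]]]; apply: lsub_trans aL.
by apply/In_subterms_App; right; exists i; apply: subterms_refl.
Qed.

(** Two names are separated by injectivity of the naming, and freshness separates a name from an
    argument that is itself a constant. *)
Lemma arg_cst_inj t u : ext_arg (A ++ B) t -> ext_arg (A ++ B) u ->
  arg_cst nm t = arg_cst nm u -> t = u.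
Proof.
have argP w : ext_arg (A ++ B) w -> ~~ is_leaf w -> In w (named (A ++ B)).
  case=> n [f [a [i [aL ->]]]] wl; apply/In_named; exists n, f, a; split=> //.
  by right; split=> //; exists i.
move=> tL uL; have tL' := ext_arg_lsub tL; have uL' := ext_arg_lsub uL.
case: t tL tL' => [c|n f a] tL tL'; case: u uL uL' => [d|m g b] uL uL' /=.
- by move=> ->.
- by move=> e; case: (nm_fresh (argP _ uL isT)); rewrite -e.
- by move=> e; case: (nm_fresh (argP _ tL isT)); rewrite e.
- by move/nm_inj; apply; apply: argP.
Qed.

Lemma both_common t : In t (lsub A) -> In t (lsub B) -> common_symbols K A B (subterms t).
Proof.
move=> tA tB; split=> [c ct|n f [a at_]].
  by split; [apply: lsub_trans tA|apply: lsub_trans tB].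
exists (existT _ n f), (existT _ n f); split; [exact: rst_refl|exact: rst_refl| |] => /=.
  by exists a; apply: lsub_trans tA.
by exists a; apply: lsub_trans tB.
Qed.

(** Freshness rules out that a constant is original on one side and a name on the other. If it is a
    name on both, injectivity gives a single term occurring in both [A] and [B], all of whose
    symbols are therefore common. *)
Lemma origin_common x : origin A x -> origin B x -> com_init K A B nm x.
Proof.
case=> [xA|[t [tA ->]]] [xB|[u [uB xu]]].
- by left.
- case: (@nm_fresh u); first by apply/In_named_cat; right.
  by rewrite -xu; apply/In_lsub_cat; left.
- case: (@nm_fresh t); first by apply/In_named_cat; left.
  by apply/In_lsub_cat; right.
- have tu : t = u by apply: nm_inj => //; apply/In_named_cat; [left|right].
  right; exists t; split=> //; first by apply/In_named_cat; left.
  by apply: both_common; [apply: named_lsub|rewrite tu; apply: named_lsub].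
Qed.

(** A name belongs to only one term and is no original constant, so it can originate on a side only
    through an occurrence of that term there. *)
Lemma origin_ext_lsub n (f : F1 S n) a L : L = A \/ L = B ->
  In (App (inr f : F01 S n) a) (lsub (A ++ B)) ->
  origin L (nm (App (inr f : F01 S n) a)) -> In (App (inr f : F01 S n) a) (lsub L).
Proof.
move=> LAB aL [fL|[t [tL e]]].
  by case: (nm_fresh (named_ext aL)); apply/In_lsub_cat; case: LAB => <-; auto.
suff -> : App (inr f : F01 S n) a = t by apply: named_lsub.
apply: nm_inj e; first exact: named_ext.
by apply/In_named_cat; case: LAB => <-; auto.
Qed.

Lemma common_ext_sim f g : sim K f g -> common_ext K A B g -> common_ext K A B f.
Proof.
by move=> fg [h1 [h2 [gh1 gh2 h1A h2B]]]; exists h1, h2; split=> //; apply: rst_trans fg _.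
Qed.

Lemma common_ext_AB f g : sim K f g ->
  ext_in (tagged f) (lsub A) /\ ext_in (tagged g) (lsub B) \/
  ext_in (tagged f) (lsub B) /\ ext_in (tagged g) (lsub A) -> common_ext K A B f.
Proof.
by move=> fg [[fA gB]|[fB gA]]; [exists f, g|exists g, f]; split=> //; apply: rst_refl.
Qed.

(* [side] in the state produced by purification. *)
Definition side0 L x := [\/ leaf_in x (lsub (pur_lits nm L)),
  leaf_in x (lsub (flatten [seq defn_clause d | d <- pur_defs nm L])) | com_init K A B nm x].

Lemma side0_args L n (f : F1 S n) c d : In (Defn f c d) (pur_defs nm L) ->
  (forall i, side0 L (c i)) /\ side0 L d.
Proof.
move=> fL; split=> [i|]; apply: Or32; apply/In_defn_clauses; exists (Defn f c d); split=> //.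
  by apply: Or32; exists i.
exact: Or33.
Qed.

End Common.
End Naming.

(** With g := f and s_i := y_i, [clause_fg (congruence k)] unfolds to [clause_ff k], so only one
    shape of clause has to be treated. *)
Definition congruence (S : signature) (k : combination S) : combination S :=
  @Combination S (cn k) (cf k) (cf k) (cRs k) (cR k) (fun i => SVar S i).

Section Combinations.
Variables (S : signature) (cst : Type).

Lemma cbind_fg (k : combination S) (s : nat -> term (F01 S) cst) :
  cbind s (clause_fg k) =
  [seq (false, atom2 (cRs k i) (s (val i)) (bind s (sterm (cs k i)))) | i <- enum 'I_(cn k)]
  ++ [:: (true, atom2 (cR k) (App (inr (cf k) : F01 S (cn k)) (fun i => s (val i)))
                  (App (inr (cg k) : F01 S (cn k)) (fun i => s (cn k + val i))))].
Proof.
rewrite /cbind /clause_fg /horn_form map_cat -!map_comp /=; congr (_ ++ _).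
  by apply: eq_map => i /=; congr (_, _); rewrite /abind /= comp_pair2.
by rewrite /abind /= comp_pair2.
Qed.

Lemma clause_fg_inst (k : combination S) (M : structure S (F01 S)) (x y : 'I_(cn k) -> car M) :
  0 < cn k -> (forall v : nat -> car M, holds_clause v (clause_fg k)) ->
  (forall i, irel (cRs k i) (pair2 (x i)
     (match cs k i with
      | SVar j => y j
      | SApp m f z => ifun (inr f : F01 S m.+1) (fun l => y (z l))
      end))) ->
  irel (cR k) (pair2 (ifun (inr (cf k) : F01 S (cn k)) x) (ifun (inr (cg k) : F01 S (cn k)) y)).
Proof.
move=> n0 Mk Rxy.
(* Variables are natural numbers, so the two tuples are extended beyond their range; [0 < cn k]
   supplies the default value. *)
pose tot (f : 'I_(cn k) -> car M) j := if insub j is Some i then f i else f (Ordinal n0).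
have totE f i : tot f (val i) = f i by rewrite /tot valK.
pose v j := if j < cn k then tot x j else tot y (j - cn k).
have vx i : v (val i) = x i by rewrite /v ltn_ord totE.
have vy i : v (cn k + val i) = y i by rewrite /v ltnNge leq_addr /= addKn totE.
move/holds_horn: (Mk v) => /=; rewrite holds_atom2 /=.
rewrite (_ : (fun i => v (val i)) = x); last exact: functional_extensionality.
rewrite (_ : (fun i => v (cn k + val i)) = y); last exact: functional_extensionality.
apply=> p /In_map [i [_ ->]]; apply/holds_atom2; move: (Rxy i); rewrite /= vx.
case: (cs k i) => [j|m f z] /=; first by rewrite vy.
rewrite (_ : (fun l => v (cn k + z l)) = (fun l => y (z l))) //.
by apply: functional_extensionality => l; apply: vy.
Qed.

End Combinations.

Lemma horn_clauseE (S : signature) (cst : Type) (C : horn S cst) : horn_clause C =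
  [seq (false, atom2 (hRs C i) (Leaf (hc C i)) (Leaf (hd C i))) | i <- enum 'I_(hn C)]
  ++ [:: (true, concl C)].
Proof. by rewrite /horn_clause /horn_form /prem -(map_comp _ _ (enum _)). Qed.

(** * The clauses of H *)

Section HornClauses.
Variables (S : signature) (cst : Type) (T0 : theory S (F0 S)) (P : Pr S 2 -> Prop).
Variables (K : seq (clause S (F01 S) nat)) (P_eq : P (peq S)) (K_form : of_combinations T0 P K).
Variables (A B : seq (literal S (F01 S) cst)) (nm : term (F01 S) cst -> cst).
Hypothesis nmP : naming A B nm.
Let D := pur_defs nm A ++ pur_defs nm B.

Lemma In_D d : In d D <-> exists n (f : F1 S n) a, In (App (inr f : F01 S n) a) (lsub (A ++ B)) /\
    d = Defn f (fun i => arg_cst nm (a i)) (nm (App (inr f : F01 S n) a)).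
Proof. by rewrite /D -pur_defs_cat; apply: In_pur_defs. Qed.

Lemma In_D_Defn n (f : F1 S n) c d : In (Defn f c d) D <->
  exists a, [/\ In (App (inr f : F01 S n) a) (lsub (A ++ B)), c = (fun i => arg_cst nm (a i))
    & d = nm (App (inr f : F01 S n) a)].
Proof.
rewrite In_D; split=> [[m [g [a [aL e]]]]|[a [aL -> ->]]]; last by exists n, f, a.
by case: e aL => ? e1 e2 ->; subst; inj_deps; subst => aL; exists a.
Qed.

Lemma In_pur_defs_Defn L n (f : F1 S n) c d : In (Defn f c d) (pur_defs nm L) ->
  exists a, [/\ In (App (inr f : F01 S n) a) (lsub L), c = (fun i => arg_cst nm (a i))
    & d = nm (App (inr f : F01 S n) a)].
Proof.
case/In_pur_defs=> m [g [a [aL e]]].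
by case: e aL => ? e1 e2 ->; subst; inj_deps; subst => aL; exists a.
Qed.

(** The congruence clause is included because separating an instance of the first scheme also uses
    the second. *)
Definition good_combination (k : combination S) :=
  [/\ In (clause_fg k) K, In (clause_fg (congruence k)) K, 0 < cn k,
      forall i, P (cRs k i) & transitive_rel T0 (cR k)].

Lemma K_combinations : exists ks : seq (combination S),
  (forall k, In k ks -> good_combination k) /\
  forall C, In C K -> exists k, In k ks /\ C = clause_fg k.
Proof.
have [ks [Kks ksP]] := K_form; exists (ks ++ [seq congruence k | k <- ks]); split.
  move=> k /In_cat [kks|/In_map [k' [kks ->]]].
    have [n0 Pk tk] := ksP _ kks.
    by split=> //; apply/Kks; exists k; split=> //; [left|right].
  have [n0 Pk tk] := ksP _ kks.
  by split=> //; apply/Kks; exists k'; split=> //; right.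
move=> C /Kks [k [kks [->|->]]].
  by exists k; split=> //; apply/In_cat; left.
by exists (congruence k); split=> //; apply/In_cat; right; apply/In_map; exists k.
Qed.

(* [K0_instance k f c d e c0 d0]: the clause [/\ c_i R_i d_i -> c0 R d0] is the
   instance of [clause_fg k] at [x := c], [y := e]. *)
Definition K0_instance (k : combination S) (c d e : 'I_(cn k) -> cst) (c0 d0 : cst) :=
  [/\ In (Defn (cf k) c c0) D, In (Defn (cg k) e d0) D
    & forall i, match cs k i with
                | SVar j => d i = e j
                | SApp m f z => In (Defn f (fun l => e (z l)) (d i)) D
                end].

(** Only extension terms with constants as arguments can be abstracted, so the instance sends every
    x_i and y_i to a constant. The symbol [f] recorded in [C] is kept apart from [cf k]: both define
    [c0], and it takes injectivity of the naming to identify them. *)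
Lemma in_K0_instance C ks : (forall C0, In C0 K -> exists k, In k ks /\ C0 = clause_fg k) ->
  in_K0 K D C ->
  exists k (f : F1 S (cn k)) c d e c0 d0,
    [/\ In k ks, C = Horn f (cRs k) c d (cR k) c0 d0, In (Defn f c c0) D
      & K0_instance (k := k) c d e c0 d0].
Proof.
move=> ksP [CD [_ [[[_ [s [/ksP [k [kks ->]] ->]]] _]]]].
case: C CD => n f Rs c d R c0 d0 /= CD; rewrite cbind_fg horn_clauseE /= => CC.
have [FA hu] := Forall2_rcons CC.
have nk : cn k = n.
  by have := Forall2_size FA; rewrite (size_map _ (enum _)) size_enum_ord (size_map _ (enum
    _)) size_enum_ord.
subst n; move: FA => /Forall2_map_enum => hprem.
case/abstracts_lit2: hu => _ /= <- /abstracts_ext [c' [c0' [sc [<-] fc]]] /abstracts_ext [e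
  [d0' [se [<-] ge]]].
have sx i : s (val i) = Leaf (c' i) by rewrite -[LHS]/((fun i => s (val i)) i) sc.
have sy i : s (cn k + val i) = Leaf (e i) by rewrite -[LHS]/((fun i => s (cn k + val i)) i) se.
have hpre i : [/\ cRs k i = Rs i, c i = c' i & abstracts D (bind s (sterm (cs k i))) (Leaf (d
  i))].
  case/abstracts_lit2: (hprem i) => _ /= Ri xi yi; split=> //.
  by move: xi; rewrite sx => xi; case: (abstracts_Leaf_l xi).
have <- : cRs k = Rs by apply: functional_extensionality => i; case: (hpre i).
have cc : c = c' by apply: functional_extensionality => i; case: (hpre i).
exists k, f, c, d, e, c0, d0; split=> //; split=> // [|i]; first by rewrite cc.
case: (hpre i) => _ _; case: (cs k i) => [j|m h z] /=; first by rewrite sy => yi;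
  case: (abstracts_Leaf_l yi).
case/abstracts_ext=> b [d' [sb [->] hb]].
rewrite (_ : (fun l => e (z l)) = b) //; apply: functional_extensionality => l.
by have := congr1 (fun h => h l) sb; rewrite /= sy => -[].
Qed.

Lemma in_K0_of_instance k c d e c0 d0 C' : K0_instance (k := k) c d e c0 d0 ->
  Kinst K [seq defn_clause d | d <- D] C' -> 
  (exists s, [/\ C' = cbind s (clause_fg k), (fun i : 'I_(cn k) => s (val i)) = (fun i => Leaf
    (c i))
     & (fun i : 'I_(cn k) => s (cn k + val i)) = (fun i => Leaf (e i))]) ->
  let C := Horn (cf k) (cRs k) c d (cR k) c0 d0 in
  in_K0 K D C /\ List.Forall2 (abstracts_lit D) C' (horn_clause C).
Proof.
move=> [cD eD dD] KC' [s [eC' sc se]] C.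
suff CC' : List.Forall2 (abstracts_lit D) C' (horn_clause C).
  by split=> //; split=> //; exists C'.
rewrite eC' cbind_fg horn_clauseE sc se; apply: List.Forall2_app.
  apply/Forall2_map_enum => i; apply/abstracts_lit2; split=> //.
    by have /= -> := congr1 (fun h => h i) sc; constructor.
  have sy j : s (cn k + val j) = Leaf (e j) by apply: (congr1 (fun h => h j) se).
  move: (dD i); case: (cs k i) => [j|m f z] /=; first by rewrite sy => ->; constructor.
  rewrite (_ : (fun l => _) = (fun l => Leaf (e (z l)))); first by constructor.
  by apply: functional_extensionality => l; apply: sy.
by constructor=> //; apply/abstracts_lit2; split=> //; constructor.
Qed.

Lemma sim_fg k : good_combination k ->
  sim K (existT _ _ (cf k)) (existT _ _ (cg k)).
Proof.
case=> kK _ _ _ _; apply: rst_step; exists (clause_fg k); split=> //=.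
  eexists; apply/In_lsub_horn; left; apply/In_asub2; left; exact: subterms_refl.
eexists; apply/In_lsub_horn; left; apply/In_asub2; right; exact: subterms_refl.
Qed.

Lemma sim_sarg k i m f z : good_combination k -> cs k i = @SApp S _ m f z ->
  sim K (existT _ _ f) (existT _ _ (cg k)).
Proof.
case=> kK _ _ _ _ ei; apply: rst_step; exists (clause_fg k); split=> //=.
  exists (fun l => yvar S (z l)); apply/In_lsub_horn; right.
  exists (atom2 (cRs k i) (xvar S i) (sterm (cs k i))); split.
    by apply/In_map; exists i; split; first exact: In_enum.
  by apply/In_asub2; right; rewrite ei; apply: subterms_refl.
eexists; apply/In_lsub_horn; left; apply/In_asub2; right; exact: subterms_refl.
Qed.

(* If [f_i(e)] occurs only on the other side, its arguments occur on both sides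
   and [f_i] is common by [~], so that its name is common. *)
Lemma K0_instance_side k c d e c0 d0 L L' : L = A /\ L' = B \/ L = B /\ L' = A ->
  good_combination k -> K0_instance (k := k) c d e c0 d0 ->
  In (Defn (cg k) e d0) (pur_defs nm L) -> forall i, side0 nm K A B L (d i).
Proof.
move=> LL' kK [_ _ dD] gL i; have [eL d0L] := side0_args K A B gL.
move: (dD i); case ei: (cs k i) => [j|m f z]; first by move=> ->.
have inL0 M : M = A \/ M = B -> forall t, In t (lsub M) -> In t (lsub (A ++ B)).
  by move=> MM t tM; apply/In_lsub_cat; case: MM => <-; auto.
have inL : forall t, In t (lsub L) -> In t (lsub (A ++ B)) by apply: inL0; tauto.
have inL' : forall t, In t (lsub L') -> In t (lsub (A ++ B)) by apply: inL0; tauto.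
move=> fD; have : In (Defn f (fun l => e (z l)) (d i)) (pur_defs nm L) \/
    In (Defn f (fun l => e (z l)) (d i)) (pur_defs nm L').
  by case/In_cat: fD; case: LL' => -[-> ->]; auto.
case=> [/(side0_args K A B) [] //|/In_pur_defs_Defn [a [aL' za da]]].
have [b [bL eb _]] := In_pur_defs_Defn gL.
(* The arguments of f_i and the corresponding ones of g have the same names, hence are the same
   terms and occur on both sides. *)
have ab l : a l = b (z l).
  apply: (arg_cst_inj nmP).
  - by exists m.+1, f, a, l; split; first exact: inL'.
  - by exists (cn k), (cg k), b, (z l); split; first exact: inL.
  - by have := congr1 (fun h => h l) za; rewrite eb => /esym.
have acom l : common_symbols K A B (subterms (a l)).
  have aL1 : In (a l) (lsub L').
    by apply: lsub_trans aL'; apply/In_subterms_App; right; exists l; apply: subterms_refl.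
  have aL2 : In (a l) (lsub L).
    by rewrite ab; apply: lsub_trans bL; apply/In_subterms_App; right; exists (z l);
      apply: subterms_refl.
  by case: LL' aL1 aL2 => -[-> ->] ? ?; apply: both_common.
apply: Or33; right; exists (App (inr f : F01 S m.+1) a); split=> //.
  by apply: named_ext; apply: inL'.
split=> [x /In_subterms_App [//|[l xl]]|p g [w /In_subterms_App [e1|[l wl]]]].
- exact: (proj1 (acom l)).
- case: e1 => ? e1 _; subst; inj_deps; case: e1 => ->.
  apply: (common_ext_AB (sim_sarg kK ei)) => /=.
  have eg : ext_in (cg k) (lsub L) by exists b.
  have ef : ext_in f (lsub L') by exists a.
  by case: LL' eg ef => -[-> ->]; tauto.
- by apply: (proj2 (acom l)); exists w.
Qed.

Definition defs_hold (M : structure S (F01 S)) (v : cst -> car M) :=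
  forall n (f : F1 S n) c d, In (Defn f c d) D ->
    ifun (inr f : F01 S n) (fun i => v (c i)) = v d.

(* What the reduction uses of a clause [/\ c_i R_i d_i -> c R d] of H, where
   [c = f(c_1,...,c_n)] and [d = g(...)]: [ok_ff] makes the first separated clause
   sound for [c_{f(t)} = f(t)], [ok_fg] the second one and the clause itself. *)
Record horn_ok (C : horn S cst) : Prop := HornOk {
  ok_lhs : In (Defn (hf C) (hc C) (hcc C)) D;
  ok_rhs : exists m (g : F1 S m) e,
    In (Defn g e (hdd C)) D /\ sim K (existT _ _ (hf C)) (existT _ _ g);
  ok_side : exists2 L, L = A \/ L = B &
    (forall i, side0 nm K A B L (hd C i)) /\ side0 nm K A B L (hdd C);
  ok_P : forall i, P (hRs C i);
  ok_trans : transitive_rel T0 (hR C);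
  ok_ff : forall M, extension T0 K M -> forall x y : 'I_(hn C) -> car M,
    (forall i, irel (s := M) (hRs C i) (pair2 (x i) (y i))) ->
    irel (s := M) (hR C) (pair2 (ifun (inr (hf C) : F01 S _) x) (ifun (inr (hf C) : F01 S _) y));
  ok_fg : forall M, extension T0 K M -> forall v : cst -> car M, defs_hold v -> forall x :
    'I_(hn C) -> car M,
    (forall i, irel (s := M) (hRs C i) (pair2 (x i) (v (hd C i)))) ->
    irel (s := M) (hR C) (pair2 (ifun (inr (hf C) : F01 S _) x) (v (hdd C))) }.

(** A name determines its term, and with it the head symbol and the arity. *)
Lemma nm_ext_inj n (f : F1 S n) c m (g : F1 S m) e d :
  In (Defn f c d) D -> In (Defn g e d) D -> existT (F1 S) n f = existT (F1 S) m g.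
Proof.
move=> /In_D_Defn [a [aL _ ->]] /In_D_Defn [b [bL _ e1]].
have := nm_inj nmP (named_ext aL) (named_ext bL) e1.
by case=> e2; subst=> e2 _; inj_deps; case: e2 => ->.
Qed.

Lemma K0_ok C : in_K0 K D C -> horn_ok C.
Proof.
move=> C0; have [ks [ksg ksK]] := K_combinations.
have [k [f [c [d [e [c0 [d0 [/ksg kg -> fD kD]]]]]]]] := in_K0_instance ksK C0.
case: (kg) (kD) => kK kcK n0 kP kR [kfD eD dD].
have <- : cf k = f.
  by have := nm_ext_inj kfD fD => e1; inj_deps.
split=> //=.
- by exists (cn k), (cg k), e; split=> //; apply: sim_fg.
- case/In_cat: eD => eL; [exists A; first by left|exists B; first by right].
    split; last exact: (proj2 (side0_args K A B eL)).
    by apply: (K0_instance_side (L' := B)) kD eL; first by left.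
  split; last exact: (proj2 (side0_args K A B eL)).
  by apply: (K0_instance_side (L' := A)) kD eL; first by right.
(* [ok_ff] is the second scheme of K. *)
- by move=> M [_ MK] x y; apply: (clause_fg_inst (k := congruence k)) => // v; apply: MK.
(* [ok_fg] is the first scheme with y_i the value of [e i]; since the definitions hold, each s_i has
   the value of d_i. *)
- move=> M [_ MK] v vD x xd; rewrite -(vD _ _ _ _ eD).
  apply: clause_fg_inst => // [w|i]; first exact: MK.
  move: (xd i) (dD i); case: (cs k i) => [j|m h z] xi; first by move<-.
  by move/vD->.
Qed.

Lemma eq_rel (M : structure S (F01 S)) (x y : car M) : irel (peq S) (pair2 x y) <-> x = y.
Proof. exact: irel_eq. Qed.

Lemma Con0_ok C : in_Con0 D C -> horn_ok C.
Proof.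
case: C => n f Rs c d R c0 d0 [/= cD dD RsE ->]; split=> //=.
- by exists n, f, d; split=> //; apply: rst_refl.
- case/In_cat: dD => dL; [exists A; first by left|exists B; first by right];
    exact: side0_args dL.
- by move=> i; rewrite RsE.
- by move=> M _ x y z /irel_eq -> /irel_eq ->; apply/irel_eq.
- move=> M _ x y xy; apply/eq_rel; congr ifun; apply: functional_extensionality => i.
  by apply/eq_rel; move: (xy i); rewrite RsE.
- move=> M _ v vD x xd; apply/eq_rel; rewrite -(vD _ _ _ _ dD); congr ifun.
  by apply: functional_extensionality => i; apply/eq_rel; move: (xd i); rewrite RsE.
Qed.

Definition inH C := in_K0 K D C \/ in_Con0 D C.

Lemma inH_ok C : inH C -> horn_ok C.
Proof. by case=> [/K0_ok|/Con0_ok]. Qed.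

(** Purification needs H as a list. Each clause is made of a definition in [D], constants of [D],
    and relations of K or equality, so all candidates can be listed and filtered. *)
Lemma inH_finite : exists H, forall C, In C H <-> inH C.
Proof.
have [ks [ksg ksK]] := K_combinations.
pose csts := flatten [seq dval d :: [seq dargs d i | i <- enum 'I_(dn d)] | d <- D].
pose rels := peq S :: flatten [seq cR k :: [seq cRs k i | i <- enum 'I_(cn k)] | k <- ks].
have argC n (f : F1 S n) c d : In (Defn f c d) D -> In d csts /\ forall i, In (c i) csts.
  move=> fD; split=> [|i]; apply/In_flatten; exists (Defn f c d); split=> //; first by left.
  by right; apply/In_map; exists i; split; first exact: In_enum.
pose all := flatten [seq
  flatten [seq flatten [seq flatten [seq
    [seq @Horn S cst (dn d) (df d) Rs (dargs d) e R (dval d) e0 | e0 <- csts]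
    | R <- rels] | e <- funs (dn d) csts] | Rs <- funs (dn d) rels] | d <- D].
apply: (ex_sublist (l := all)) => C HC.
have : [/\ In (Defn (hf C) (hc C) (hcc C)) D, forall i, In (hRs C i) rels,
           forall i, In (hd C i) csts, In (hR C) rels & In (hdd C) csts].
  case: HC => [/(in_K0_instance ksK)|].
    case=> k [f [c [d [e [c0 [d0 [kks -> fD [cD eD dD]]]]]]]]; split=> //=.
    - move=> i; right; apply/In_flatten; exists k; split=> //; right.
      by apply/In_map; exists i; split; first exact: In_enum.
    - move=> i; have [_ eC] := argC _ _ _ _ eD.
      move: (dD i); case: (cs k i) => [j ->|m g z /argC []] //.
    - by right; apply/In_flatten; exists k; split=> //; left.
    - by case: (argC _ _ _ _ eD).
  case=> cD dD RsE RE; have [dC dsC] := argC _ _ _ _ dD.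
  by split=> // [i|]; rewrite ?RsE ?RE; left.
case: C {HC} => n f Rs c d R c0 d0 /= [fD RsC dC RC d0C].
apply/In_flatten; exists (Defn f c c0); split=> //.
apply/In_flatten; exists Rs; split; first exact: In_funs.
apply/In_flatten; exists d; split; first exact: In_funs.
by apply/In_flatten; exists R; split=> //; apply/In_map; exists d0.
Qed.

End HornClauses.

Lemma Forall2_In_l T U (R : T -> U -> Prop) s1 s2 x :
  List.Forall2 R s1 s2 -> In x s1 -> exists2 y, In y s2 & R x y.
Proof.
by elim=> //= a b l1 l2 ab _ IH [<-|/IH [y yl xy]]; [exists b; [left|]|exists y; [right|]].
Qed.

Lemma Forall2_In_r T U (R : T -> U -> Prop) s1 s2 y :
  List.Forall2 R s1 s2 -> In y s2 -> exists2 x, In x s1 & R x y.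
Proof.
by elim=> //= a b l1 l2 ab _ IH [<-|/IH [x xl xy]]; [exists a; [left|]|exists x; [right|]].
Qed.

(** * Locality *)

Section PartialModel.
Variables (S : signature) (cst : Type) (D : seq (defn S cst)).
Variables (M : structure S (F0 S)) (v : cst -> car M).
Hypothesis D_functional : forall n (f : F1 S n) c d c' d',
  In (Defn f c d) D -> In (Defn f c' d') D ->
  (forall i, v (c i) = v (c' i)) -> v d = v d'.

Definition table n (f : F1 S n) (args : 'I_n -> car M) (x : car M) : Prop :=
  exists c d, [/\ In (Defn f c d) D, args = (fun i => v (c i)) & x = v d].

(** An extension function has a value exactly where some definition gives one under [v]. By
    [D_functional], which is what Con_0 expresses at [v], the chosen value does not depend on the
    definition. *)
Definition partial_model : pstructure S cst :=
  @PStructure S cst M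
    (fun n f args =>
       match excluded_middle_informative (exists x, table f args x) with
       | left fx => Some (proj1_sig (constructive_indefinite_description _ fx))
       | right _ => None
       end)
    (fun c => Some (v c)).

Lemma partial_model_ext n (f : F1 S n) c d :
  In (Defn f c d) D -> pext partial_model f (fun i => v (c i)) = Some (v d).
Proof.
move=> fD /=; case: excluded_middle_informative => [fx|[]]; last by exists (v d), c, d.
case: constructive_indefinite_description => x /= [c' [d' [fD' ec ->]]]; congr Some.
by apply: D_functional fD' fD _ => i; rewrite -[LHS]/((fun i => v (c' i)) i) -ec.
Qed.

Lemma peval_abstracts t u : abstracts D t u -> @peval S cst partial_model t (eval v u).
Proof.
elim=> [c|n f a b _ IH|n f c d fD] /=; first exact: PLeaf.
  exact: (@PBase S cst partial_model n f a (fun i => eval v (b i))).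
apply: (@PExt S cst partial_model n f (fun i => Leaf (c i)) (fun i => v (c i)));
  last exact: partial_model_ext.
by move=> i; apply: PLeaf.
Qed.

Lemma pdefined_abstracts t u w : abstracts D t u -> In w (subterms t) -> pdefined partial_model w.
Proof.
move=> tu; elim: tu w => [c|n f a b ab IH|n f c d fD] w.
- by case=> // <-; exists (v c); apply: PLeaf.
- case/In_subterms_App=> [->|[i /IH //]].
  by eexists; apply: peval_abstracts; apply: AbsBase ab.
- case/In_subterms_App=> [->|[i [<-|//]]].
    by eexists; apply: peval_abstracts; apply: AbsExt fD.
  by exists (v (c i)); apply: PLeaf.
Qed.

Lemma pdefined_abstracts_lits L L' w :
  List.Forall2 (abstracts_lit D) L L' -> In w (lsub L) -> pdefined partial_model w.
Proof.
move=> LL' /In_lsub [l [lL /In_asub [i wi]]].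
have [l' _ ll'] := Forall2_In_l LL' lL.
by case: ll' i wi => b n p a a' aa' i /=; apply: pdefined_abstracts.
Qed.

Lemma weakly_satisfies_abstracts C C' :
  List.Forall2 (abstracts_lit D) C C' -> holds_clause v C' -> weakly_satisfies partial_model C.
Proof.
move=> CC' [l' [l'C vl']]; right; split=> [t|]; first exact: pdefined_abstracts_lits CC'.
have [l lC ll'] := Forall2_In_r CC' l'C; exists l; split=> //.
case: ll' vl' => b n p a a' aa'; rewrite /holds_lit /holds_atom /= => vl'.
by exists (fun i => eval v (a' i)); split=> // i; apply: peval_abstracts.
Qed.

End PartialModel.

Definition lembed (S : signature) X (l : literal S (F0 S) X) : literal S (F01 S) X :=
  (l.1, aembed l.2).

Lemma abstracts_embed (S : signature) (cst : Type) (D : seq (defn S cst)) (t : term (F0 S) cst) :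
  abstracts D (embed t) t.
Proof. by elim: t => [c|n f a IH] /=; constructor. Qed.

Lemma holds_lembed (S : signature) X (M : structure S (F01 S)) (v : X -> car M) l :
  holds_lit v (lembed l) <-> holds_lit (M := reduct M) v l.
Proof.
case: l => b p; rewrite /holds_lit /lembed /holds_atom /=.
rewrite (_ : (fun i => _) = (fun i => eval (M := reduct M) v (aargs p i))) //.
by apply: functional_extensionality => i; apply: eval_embed.
Qed.

(** * From locality to unsatisfiability in the base theory *)

Section Completeness.
Variables (S : signature) (cst : Type) (T0 : theory S (F0 S)) (P : Pr S 2 -> Prop).
Variables (K : seq (clause S (F01 S) nat)).
Hypotheses (K_local : local_extension cst T0 K) (K_form : of_combinations T0 P K).
Variables (A B : seq (literal S (F01 S) cst)) (nm : term (F01 S) cst -> cst).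
Hypothesis AB_unsat : unsat (extension T0 K) (A ++ B).
Let D := pur_defs nm A ++ pur_defs nm B.

Lemma eval_pur (M : structure S (F01 S)) (v : cst -> car M) L :
  (forall t, In t (lsub L) -> In t (lsub (A ++ B))) ->
  defs_hold A B nm v -> holds_all (M := reduct M) v (pur_lits nm L) ->
  forall t, In t (lsub L) -> eval (M := reduct M) v (pur nm t) = eval v t.
Proof.
move=> LAB vD vL; elim=> [c //|n [f|f] a IH] tL.
  rewrite /=; congr ifun; apply: functional_extensionality => i; apply: IH.
  by apply: lsub_trans tL; apply/In_subterms_App; right; exists i; apply: subterms_refl.
have aL i : In (a i) (lsub L).
  by apply: lsub_trans tL; apply/In_subterms_App; right; exists i; apply: subterms_refl.
have fD : In (Defn f (fun i => arg_cst nm (a i)) (nm (App (inr f : F01 S n) a))) D.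
  by apply/In_D_Defn; exists a; split=> //; apply: LAB.
have := vD _ _ _ _ fD; rewrite /= => <-; congr ifun.
(* Constants and extension terms have their [arg_cst] as purification; for a base term t the
   equation c_t = t in [pur_lits] is used. *)
apply: functional_extensionality => i; rewrite -IH //; case ai: (a i) => [c|m [g|g] b] //.
have : In (true, atom2 (peq S) (Leaf (nm (a i))) (pur nm (a i))) (pur_lits nm L).
  by apply/In_pur_lits; right; exists n, f, a, i, m, g, b.
by move/vL; rewrite ai /holds_lit => /holds_atom2 /irel_eq.
Qed.

Lemma holds_pur (M : structure S (F01 S)) (v : cst -> car M) L :
  (forall t, In t (lsub L) -> In t (lsub (A ++ B))) ->
  defs_hold A B nm v -> holds_all (M := reduct M) v (pur_lits nm L) -> holds_all v L.
Proof.
move=> LAB vD vL l lL.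
have : holds_lit (M := reduct M) v (pur_lit nm l) by apply: vL; apply/In_pur_lits; left; exists l.
rewrite /holds_lit /holds_atom /=.
rewrite (_ : (fun i => _) = (fun i => eval v (aargs l.2 i))) //.
apply: functional_extensionality => i; apply: eval_pur vD vL _ _ => //.
by apply/In_lsub; exists l; split=> //; apply/In_asub; exists i; apply: subterms_refl.
Qed.

(** This is the set G to which locality is applied: extension functions occur in it only in
    definitions. *)
Definition purified : seq (clause S (F01 S) cst) :=
  [seq [:: lembed l] | l <- pur_lits nm A ++ pur_lits nm B] ++ [seq defn_clause d | d <- D].

Lemma purified_unsat : unsat_clauses (extension T0 K) purified.
Proof.
move=> M MT v vG; apply: (AB_unsat (M := M) MT (v := v)).
have vD : defs_hold A B nm v.
  move=> n f c d fD; have : holds_clause v (defn_clause (Defn f c d)).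
    by apply: vG; apply/In_cat; right; apply/In_map; exists (Defn f c d).
  by case=> l [[<-|//]] /holds_atom2 /irel_eq.
have : holds_all (M := reduct M) v (pur_lits nm A ++ pur_lits nm B).
  move=> l lAB; apply/holds_lembed.
  have : holds_clause v [:: lembed l].
    by apply: vG; apply/In_cat; left; apply/In_map; exists l.
  by case=> l' [[<-|//]].
case/holds_all_cat=> vA vB; apply/holds_all_cat; split; apply: holds_pur vD _ => // t tL;
  by apply/In_lsub_cat; auto.
Qed.

(** Both the f, g of a combination and the f_i have arity at least 1 and variables as arguments, so
    K contributes no ground term to st(K,G). *)
Lemma K_term_leaf u : In u (lsub (flatten K)) -> exists x, leaf_in x (subterms u).
Proof.
have [ks [ksg ksK]] := K_combinations K_form.
case/In_lsub=> l [lK ul].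
have [C [CK lC]] : exists C, In C K /\ In l C.
  by move: lK; rewrite -[in flatten _](map_id K) => /In_flatten.
have [k [/ksg [_ _ n0 _ _] eC]] := ksK _ CK; rewrite {}eC in lC.
have argP m (f : F01 S m) (a : 'I_m -> term (F01 S) nat) w : 0 < m ->
    (forall i, exists x, a i = Leaf x) -> In w (subterms (App f a)) ->
    exists x, leaf_in x (subterms w).
  move=> m0 ax /In_subterms_App [->|[i]].
    have [x ex] := ax (Ordinal m0); exists x; apply/In_subterms_App; right.
    by exists (Ordinal m0); rewrite ex; left.
  by have [x ->] := ax i; case=> // <-; exists x; left.
have : In u (lsub (clause_fg k)) by apply/In_lsub; exists l.
case/In_lsub_horn=> [/In_asub2 [] /argP|[p [/In_map [i [_ ->]]]]].
- by apply=> // i; exists (val i).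
- by apply=> // i; exists (cn k + val i).
case/In_asub2=> [[<-|//]|]; first by exists (val i); left.
case: (cs k i) => [j [<-|//]|m f z /argP]; first by exists (cn k + val j); left.
by apply=> // l'; exists (cn k + val (z l')).
Qed.

Lemma st_purified t : st K purified t ->
  (exists u, abstracts D t u) /\
  (ext_headed t -> exists n (f : F1 S n) c d, In (Defn f c d) D /\ t = App (inr f : F01 S n)
    (fun i => Leaf (c i))).
Proof.
case=> [|[u [/K_term_leaf [x ux] nux _]]]; last by case: (nux x).
rewrite /purified flatten_cat => /In_lsub_cat [|].
  rewrite (flatten_map1 _ (pur_lits nm A ++ pur_lits nm B)).
  case/In_lsub=> _ [/In_map [l [lAB ->]] /In_asub [i /In_subterms_embed [w [_ ->]]]].
  split; first by exists w; apply: abstracts_embed.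
  by case=> n [f [a /embed_not_ext]].
case/In_defn_clauses=> d [dD td]; case: td => [->|[i ->]|->].
- split; first by exists (Leaf (dval d)); apply: AbsExt; case: d dD.
  by move=> _; exists (dn d), (df d), (dargs d), (dval d); split=> //; case: d dD.
- by split; [exists (Leaf (dargs d i)); constructor|case=> ? [? [?]]].
- by split; [exists (Leaf (dval d)); constructor|case=> ? [? [?]]].
Qed.

(** The terms f(x) and g(y) of the conclusion contain all variables of the clause. Lying in st, they
    must be left-hand sides of definitions, so all variables are instantiated by constants of [D]
    and the instance reduces to a clause of K_0. *)
Lemma Kinst_purified C : Kinst K purified C -> exists h,
  in_K0 K D h /\ List.Forall2 (abstracts_lit D) C (horn_clause h).
Proof.
have [ks [ksg ksK]] := K_combinations K_form.
case=> -[_ [s [/ksK [k [/ksg [kK _ n0 _ _] ->]] eC]]] stC.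
have extC n (f : F1 S n) a : In (App (inr f : F01 S n) a) (lsub C) ->
    exists c d, In (Defn f c d) D /\ a = (fun i => Leaf (c i)).
  move=> fC; have [_ stf] := st_purified (stC _ fC (ex_intro _ n (ex_intro _ f (ex_intro _ a
    erefl)))).
  case: stf => [|m [g [c [d [gD e]]]]]; first by exists n, f, a.
  case: e => e1 e2 e3; subst; inj_deps; subst.
  by exists c, d.
have KDC : Kinst K [seq defn_clause d | d <- D] C.
  split; first by exists (clause_fg k), s.
  move=> t tC [n [f [a et]]]; rewrite et in tC *; have [c [d [fD ->]]] := extC _ _ _ tC.
  by left; apply/In_defn_clauses; exists (Defn f c d); split=> //; apply: Or31.
have inC t : (exists i, In t (subterms (bind s (sterm (cs k i))))) \/
    t = App (inr (cf k) : F01 S _) (fun i : 'I_(cn k) => s (val i)) \/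
    t = App (inr (cg k) : F01 S _) (fun i : 'I_(cn k) => s (cn k + val i)) -> In t (lsub C).
  rewrite eC cbind_fg => tC; apply/In_lsub_cat; case: tC => [[i ti]|tC]; [left|right].
    apply/In_lsub; exists (false, atom2 (cRs k i) (s (val i)) (bind s (sterm (cs k i)))).
    split; last by apply/In_asub2; right.
    by apply/In_map; exists i; split; first exact: In_enum.
  apply/In_lsub; eexists; split; first by left.
  by apply/In_asub2; case: tC => ->; [left|right]; apply: subterms_refl.
have [c [c0 [cD sc]]] := extC _ _ _ (inC _ (or_intror (or_introl erefl))).
have [e [d0 [eD se]]] := extC _ _ _ (inC _ (or_intror (or_intror erefl))).
have sy j : s (cn k + val j) = Leaf (e j) by apply: (congr1 (fun h => h j) se).
(* If s_i is f_i(z), its instance lies in st too, and d_i is a constant defined for it. *)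
have dP i : { d | match cs k i with
                  | SVar j => d = e j
                  | SApp m f z => In (Defn f (fun l => e (z l)) d) D
                  end }.
  apply: constructive_indefinite_description.
  have := fun t ti => inC t (or_introl (ex_intro _ i ti)).
  case: (cs k i) => [j|m f z] /= tC; first by exists (e j).
  have [b [d [fD eb]]] := extC _ _ _ (tC _ (or_introl erefl)); exists d.
  rewrite (_ : (fun l => e (z l)) = b) //; apply: functional_extensionality => l.
  by have := congr1 (fun h => h l) eb; rewrite /= sy => -[].
have inst : K0_instance A B nm (k := k) c (fun i => proj1_sig (dP i)) e c0 d0.
  by split=> // i; apply: (proj2_sig (dP i)).
have := in_K0_of_instance inst KDC; case; first by exists s.
by move=> hK hF; eexists; split; [exact: hK|exact: hF].
Qed.

Lemma base_reduction (M : structure S (F0 S)) (v : cst -> car M) : T0 M ->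
  holds_all v (pur_lits nm A ++ pur_lits nm B) ->
  ~ (forall C, inH K A B nm C -> holds_clause v (horn_clause C)).
Proof.
move=> MT vL vH; apply: (proj1 (K_local purified) purified_unsat).
have Df n (f : F1 S n) c d c' d' : In (Defn f c d) D -> In (Defn f c' d') D ->
    (forall i, v (c i) = v (c' i)) -> v d = v d'.
  move=> fD fD' cc'; pose C := Horn f (fun _ => peq S) c c' (peq S) d d'.
  have /holds_horn : holds_clause v (horn_clause C) by apply: vH; right.
  move=> hC; apply/(irel_eq (s := M)); apply/(holds_atom2 v (peq S) (Leaf d) (Leaf d'));
    apply: hC.
  by move=> p /In_map [i [_ ->]]; apply/holds_atom2/irel_eq; apply: cc'.
exists (partial_model D v); split=> //.
  move=> t /st_purified [[u tu] _].
  by exists (eval v u); apply: peval_abstracts tu.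
move=> C [/Kinst_purified [h [hK hF]]|].
  by apply: (weakly_satisfies_abstracts Df hF); apply: vH; left.
case/In_cat=> /In_map [x [xL ->]].
  apply: (weakly_satisfies_abstracts Df (C' := [:: x])).
    constructor=> //; case: x {xL} => b [n p a].
    by rewrite /lembed /aembed /=; apply: AbsLit => i; apply: abstracts_embed.
  by exists x; split; [left|apply: vL].
(* A definition f(c) = d abstracts to the trivial equation d = d. *)
apply: (weakly_satisfies_abstracts Df (C' := [:: (true, atom2 (peq S) (Leaf (dval x)) (Leaf
  (dval x)))])).
  constructor=> //; apply/abstracts_lit2; split=> //; last by constructor.
  by apply: AbsExt; case: x xL.
exists (true, atom2 (peq S) (Leaf (dval x)) (Leaf (dval x))); split; first by left.
rewrite /holds_lit; apply/holds_atom2; exact/irel_eq.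
Qed.

End Completeness.

(** * Denotations of the introduced constants *)

Section Denotation.
Variables (S : signature) (cst : eqType).

(** The latest entry comes first and its term may mention constants introduced earlier, so that term
    is interpreted by the tail. *)
Fixpoint denote (dn : seq (cst * term (F01 S) cst)) (c : cst) : term (F01 S) cst :=
  if dn is d :: dn' then if c == d.1 then bind (denote dn') d.2 else denote dn' c
  else Leaf c.

(** With the iterated replacement turned into one substitution, truth of the expansion becomes truth
    of I_0 at the values of the denotations. *)
Lemma expandE dn (I0 : formula S (F0 S) cst) : expand dn I0 = fbind (denote dn) (fembed I0).
Proof.
rewrite /expand; elim: dn (fembed I0) => [|d dn IH] I /=; first by rewrite fbind_Leaf.
rewrite IH fbind_fbind; congr fbind; apply: functional_extensionality => c.
by case: eqP.
Qed.

End Denotation.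

(** * Existence of fresh names *)

Section Fresh.
Variables (S : signature) (cst : eqType) (cst_infinite : forall l : seq cst, exists c, c
  \notin l).

Definition leaves F X (ts : seq (term F X)) : seq X :=
  flatten [seq if t is Leaf x then [:: x] else [::] | t <- ts].

Lemma In_leaves F X (x : X) (ts : seq (term F X)) : leaf_in x ts -> In x (leaves ts).
Proof. by move=> xt; apply/In_flatten; exists (Leaf x); split; last left. Qed.

Lemma ex_naming (A B : seq (literal S (F01 S) cst)) : exists nm, naming A B nm.
Proof.
suff [nm [nm1 nm2]] : exists nm : term (F01 S) cst -> cst,
    (forall t, In t (named (A ++ B)) -> nm t \notin leaves (lsub (A ++ B))) /\
    (forall t u, In t (named (A ++ B)) -> In u (named (A ++ B)) -> nm t = nm u -> t = u).
  by exists nm; split=> // t /nm1 /negP nt tL; apply: nt; apply/In_mem/In_leaves.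
elim: (named _) => [|t l [nm [nm1 nm2]]].
  by have [c _] := cst_infinite [::]; exists (fun _ => c).
have [c] := cst_infinite ([seq nm u | u <- l] ++ leaves (lsub (A ++ B))).
rewrite mem_cat negb_or => /andP [/negP cl cL].
(* The list may repeat a term, which then keeps its name. *)
have [tl|tl] := classic (In t l).
  exists nm; split=> [u [<-|]|u w [<-|ul] [<-|wl]]; auto.
have cnm u : In u l -> c = nm u -> False.
  by move=> ul cu; apply: cl; apply/In_mem/In_map; exists u.
exists (fun u => if excluded_middle_informative (u = t) then c else nm u); split.
  by move=> u ul; case: excluded_middle_informative => ut //; case: ul => [/esym //|/nm1].
move=> u w ul wl; case: excluded_middle_informative => ut;
  case: excluded_middle_informative => wt /=.
- by move=> _; rewrite ut wt.
- by case: wl => [/esym //|wl]; move/(cnm _ wl).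
- by case: ul => [/esym //|ul] /esym; move/(cnm _ ul).
- by case: ul => [/esym //|ul]; case: wl => [/esym //|wl]; apply: nm2.
Qed.

End Fresh.

(** * The invariant of a run *)

Section Run.
Variables (S : signature) (cst : eqType) (T0 : theory S (F0 S)) (P : Pr S 2 -> Prop).
Variables (K : seq (clause S (F01 S) nat)) (P_eq : P (peq S)) (K_form : of_combinations T0 P K).
Variables (A B : seq (literal S (F01 S) cst)).

(** The denotation of these constants no longer changes, since a constant introduced later is not
    among them. *)
Definition known (s : rstate S cst) x :=
  leaf_in x (lsub (A ++ B)) \/ In x [seq d.1 | d <- den s].

Definition one_sided nm s (X : cst -> Prop) :=
  exists2 L, L = A \/ L = B & forall x, X x -> side nm L s x.

(** The fields on [com] and [den] control the symbols of the final formula. [inv_sep] and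
    [inv_Delta] allow the split into two sides. For unsatisfiability of the base problem, Delta
    makes up for the clauses removed from H ([inv_done]) and itself follows from A_0, B_0 and H_sep
    ([inv_sep_Delta]). [inv_sound] is soundness in T_1 when each constant takes the value of its
    denotation. *)
Record run_invariant (nm : term (F01 S) cst -> cst) (s : rstate S cst) : Prop := Invariant {
  inv_nm : naming A B nm;
  inv_com0 : forall x, com_init K A B nm x -> com s x;
  inv_com_known : forall x, com s x -> known s x;
  inv_com_denote : forall x, com s x -> common_symbols K A B (subterms (denote (den s) x));
  inv_leaf : forall x, leaf_in x (lsub (A ++ B)) -> denote (den s) x = Leaf x;
  inv_named : forall t, In t (named (A ++ B)) ->
    denote (den s) (nm t) = t /\ In (nm t) [seq d.1 | d <- den s];
  inv_cur : forall C, In C (Hcur s) -> inH K A B nm C;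
  inv_done : forall C, inH K A B nm C -> In C (Hcur s) \/
    forall M, T0 M -> forall v : cst -> car M,
      (forall p, In p (Delta s) -> holds_atom v p) -> holds_atom v (concl C);
  inv_sep : forall C, In C (Hsep s) -> one_sided nm s (fun x => leaf_in x (lsub C));
  inv_Delta : forall p, In p (Delta s) -> one_sided nm s (fun x => leaf_in x (asub p));
  inv_sep_Delta : forall M, T0 M -> forall v : cst -> car M,
    holds_all v (pur_lits nm A ++ pur_lits nm B) -> holds_clauses v (Hsep s) ->
    forall p, In p (Delta s) -> holds_atom v p;
  inv_sound : forall M, extension T0 K M -> forall v : cst -> car M,
    holds_clauses (M := reduct M) (fun x => eval v (denote (den s) x)) (Hsep s) }.

Lemma side_side0 nm (s : rstate S cst) L x : (forall x, com_init K A B nm x -> com s x) ->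
  side0 nm K A B L x -> side nm L s x.
Proof. by move=> c0 [x1|x1|/c0 x1]; [apply: Or31|apply: Or32|apply: Or33]. Qed.

Lemma side_origin nm (s : rstate S cst) L x : side nm L s x -> origin nm L x \/ com s x.
Proof. by case=> [xL|xL|]; [left; apply: origin_pur_lits|left; apply: origin_defns|right]. Qed.

Section Denoting.
Variables (nm : term (F01 S) cst -> cst) (X : cst -> term (F01 S) cst).
Hypothesis X_leaf : forall x, leaf_in x (lsub (A ++ B)) -> X x = Leaf x.
Hypothesis X_named : forall t, In t (named (A ++ B)) -> X (nm t) = t.

Lemma denote_arg n (f : F1 S n) a i : In (App (inr f : F01 S n) a) (lsub (A ++ B)) ->
  X (arg_cst nm (a i)) = a i.
Proof.
move=> aL; have ai : In (a i) (lsub (A ++ B)).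
  by apply: lsub_trans aL; apply/In_subterms_App; right; exists i; apply: subterms_refl.
case e: (a i) => [c|m g b] /=; rewrite e in ai; first exact: X_leaf.
apply: X_named; apply/In_named; exists n, f, a; split=> //; right; split=> //.
by exists i.
Qed.

(** [X] is any denotation that undoes the naming, so this applies before and after a separation step
    extends the denotation. *)
Lemma denote_defs (M : structure S (F01 S)) (v : cst -> car M) :
  defs_hold A B nm (fun x => eval v (X x)).
Proof.
move=> n f c d /In_D_Defn [a [aL -> ->]]; rewrite X_named; last exact: named_ext.
by rewrite /=; congr ifun; apply: functional_extensionality => i; rewrite (denote_arg _ aL).
Qed.

Lemma denote_pur t : In t (lsub (A ++ B)) -> bind X (embed (pur nm t)) = t.
Proof.
elim: t => [c|n [f|f] a IH] tL /=.
- exact: X_leaf.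
- congr App; apply: functional_extensionality => i; apply: IH.
  by apply: lsub_trans tL; apply/In_subterms_App; right; exists i; apply: subterms_refl.
- by apply: X_named; apply: named_ext.
Qed.

Lemma denote_pur_lits (M : structure S (F01 S)) (v : cst -> car M) L :
  (forall t, In t (lsub L) -> In t (lsub (A ++ B))) -> holds_all v L ->
  holds_all (M := reduct M) (fun x => eval v (X x)) (pur_lits nm L).
Proof.
move=> LAB vL.
have ev t : In t (lsub L) -> eval (M := reduct M) (fun x => eval v (X x)) (pur nm t) = eval v t.
  by move=> tL; rewrite -eval_embed -eval_bind denote_pur //; apply: LAB.
move=> l /In_pur_lits [[l0 l0L ->]|[n [f [a [i [m [g [b [aL ai ->]]]]]]]]].
  move: (vL _ l0L); rewrite /holds_lit /holds_atom /=.
  rewrite (_ : (fun i => eval v _) = (fun i => eval (M := reduct M) (fun x => eval v (X x))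
    (pur nm (aargs l0.2 i)))) //.
  apply: functional_extensionality => i; symmetry; apply: ev.
  by apply/In_lsub; exists l0; split=> //; apply/In_asub; exists i; apply: subterms_refl.
apply/holds_atom2/irel_eq; rewrite ev.
  by have := denote_arg i (LAB _ aL); rewrite {1}ai /= -ai => ->.
by apply: lsub_trans aL; apply/In_subterms_App; right; exists i; apply: subterms_refl.
Qed.

Lemma denote_horn (M : structure S (F01 S)) (v : cst -> car M) C :
  extension T0 K M -> horn_ok T0 P K A B nm C ->
  holds_clause (M := reduct M) (fun x => eval v (X x)) (horn_clause C).
Proof.
move=> MT okC; have vD := denote_defs v; apply/holds_horn => vp; apply/holds_atom2.
rewrite /= -(vD _ _ _ _ (ok_lhs okC)); apply: (ok_fg okC MT vD) => i.
have /vp /holds_atom2 : In (atom2 (hRs C i) (Leaf (hc C i)) (Leaf (hd C i))) (prem C).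
  by apply/In_map; exists i; split; first exact: In_enum.
by [].
Qed.

End Denoting.

Section Invariants.
Variables (nm : term (F01 S) cst -> cst) (s : rstate S cst).
Hypothesis I : run_invariant nm s.

(** Apart from the constants already common, a side contains only constants originating there, and
    [origin_common] covers those with origins on both sides. *)
Lemma side_both x : side nm A s x -> side nm B s x -> com s x.
Proof.
case/side_origin=> // xA; case/side_origin=> // xB.
apply: (inv_com0 I); apply: origin_common xA xB; exact: inv_nm I.
Qed.

Lemma side_known L x : L = A \/ L = B -> side nm L s x -> known s x.
Proof.
move=> LAB /side_origin [[xL|[t [tL ->]]]|/(inv_com_known I) //].
  by left; apply/In_lsub_cat; case: LAB => <-; auto.
by right; apply: (proj2 (inv_named I _)); apply/In_named_cat; case: LAB => <-; auto.
Qed.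

Lemma side_ext L n (f : F1 S n) a : L = A \/ L = B ->
  In (App (inr f : F01 S n) a) (lsub (A ++ B)) -> side nm L s (nm (App (inr f : F01 S n) a)) ->
  ext_in f (lsub L) \/ common_ext K A B (existT _ n f).
Proof.
move=> LAB aL /side_origin [/(origin_ext_lsub (inv_nm I) LAB aL) fL|/(inv_com_denote I) [_ fc]].
  by left; exists a.
right; apply: fc; rewrite (proj1 (inv_named I (named_ext aL))).
by exists a; apply: subterms_refl.
Qed.

(** The constants of the conclusion lie on opposite sides and name terms headed by f and by some g
    with f ~ g. Either both heads occur on their respective sides, or one of the names is already
    common; in each case f is common, so f(t_1,...,t_n) may enter the interpolant. *)
Lemma mixed_common C : horn_ok T0 P K A B nm C -> mixed nm A B s C ->
  common_ext K A B (existT _ _ (hf C)).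
Proof.
move=> okC mC.
have [a [aL _ ea]] := iffLR (In_D_Defn _ _ _ _ _ _) (ok_lhs okC).
have [m [g [e [gD fg]]]] := ok_rhs okC.
have [b [bL _ eb]] := iffLR (In_D_Defn _ _ _ _ _ _) gD.
have [] : (side nm A s (hcc C) /\ side nm B s (hdd C)) \/ (side nm B s (hcc C) /\ side nm A s
  (hdd C)).
- by case: mC => -[_ ? _ ?]; auto.
- rewrite ea eb => -[/side_ext fA /side_ext gB].
  case: (fA (or_introl erefl) aL) => // fA'.
  case: (gB (or_intror erefl) bL) => [gB'|]; last exact: common_ext_sim.
  by apply: (common_ext_AB fg); left.
- rewrite ea eb => -[/side_ext fA /side_ext gB].
  case: (fA (or_intror erefl) aL) => // fA'.
  case: (gB (or_introl erefl) bL) => [gB'|]; last exact: common_ext_sim.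
  by apply: (common_ext_AB fg); right.
Qed.

(** A definition stems from one side, which covers the c_i and c, and [ok_side] covers the d_i and
    d. These two sides are opposite or equal, so every clause that is not mixed can be assigned to
    one part. *)
Lemma horn_sides C : horn_ok T0 P K A B nm C -> mixed nm A B s C \/
  exists2 L, L = A \/ L = B &
    [/\ forall i, side nm L s (hc C i), side nm L s (hcc C),
        forall i, side nm L s (hd C i) & side nm L s (hdd C)].
Proof.
move=> okC; have s0 := side_side0 (inv_com0 I).
have [L LAB [cL c0L]] : exists2 L, L = A \/ L = B &
    (forall i, side0 nm K A B L (hc C i)) /\ side0 nm K A B L (hcc C).
  by case/In_cat: (ok_lhs okC) => fL; [exists A|exists B]; auto; apply: side0_args fL.
have [L' LAB' [dL d0L]] := ok_side okC.
have [Lc Ld] : (forall i, side nm L s (hc C i)) /\ (forall i, side nm L' s (hd C i)) by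
  split=> i; apply: s0.
have [Lc0 Ld0] := (s0 _ _ c0L, s0 _ _ d0L).
case: LAB Lc Lc0 {cL c0L} => -> Lc Lc0; case: LAB' Ld Ld0 {dL d0L} => -> Ld Ld0.
- by right; exists A; [left|split].
- by left; left; split.
- by left; right; split.
- by right; exists B; [right|split].
Qed.

End Invariants.

Lemma denote_initial nm l : naming A B nm -> (forall t, In t l -> In t (named (A ++ B))) ->
  let X := denote [seq (nm t, t) | t <- l] in
  (forall x, leaf_in x (lsub (A ++ B)) -> X x = Leaf x) /\
  forall t, In t l -> X (nm t) = t.
Proof.
move=> nmP; elim: l => [|u l IH] lL /=; first by split.
have [IHx IHt] := IH (fun t tl => lL t (or_intror tl)).
have uL : In u (named (A ++ B)) by apply: lL; left.
(* Named terms contain only original constants, none of which is a name, so the remaining entries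
   leave [u] unchanged. *)
have Xu : bind (denote [seq (nm t, t) | t <- l]) u = u.
  rewrite -[RHS]bind_Leaf; apply: bind_eq_in => x xu; apply: IHx.
  by apply: lsub_trans xu _; apply: named_lsub.
split=> [x xL|t tl]; case: eqP => // e.
- by case: (nm_fresh nmP uL); rewrite -e.
- exact: IHx.
- by apply: (etrans Xu); apply: (nm_inj nmP uL) (lL _ tl) (esym e).
- by apply: IHt; case: tl e => [->|].
Qed.

Lemma invariant_initial nm H : naming A B nm -> (forall C, In C H <-> inH K A B nm C) ->
  run_invariant nm (RState (com_init K A B nm) [seq (nm t, t) | t <- named (A ++ B)] H [::] [::]).
Proof.
move=> nmP HP; have [Xx Xt] := denote_initial nmP (fun t => id).
have keyP t : In t (named (A ++ B)) -> In (nm t) [seq d.1 | d <- [seq (nm t, t) | t <- named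
  (A ++ B)]].
  by move=> tL; apply/In_map; exists (nm t, t); split=> //; apply/In_map; exists t.
split=> //=.
- move=> x [[xA xB]|[t [tL -> _]]]; first by left; apply/In_lsub_cat; left.
  by right; apply: keyP.
- move=> x [[xA xB]|[t [tL -> tc]]]; last by rewrite Xt.
  rewrite Xx; last by apply/In_lsub_cat; left.
  by split=> [c [[<-]|//]|n f [a [|]]].
- by move=> t tL; split; [apply: Xt|apply: keyP].
- by move=> C /HP.
- by move=> C /HP; left.
- by move=> M MT v C [].
Qed.

Lemma one_sided_mono nm (s s' : rstate S cst) X : (forall x, com s x -> com s' x) ->
  one_sided nm s X -> one_sided nm s' X.
Proof.
by move=> cc [L LAB LX]; exists L => // x /LX [? |? |/cc ?];
  [apply: Or31|apply: Or32|apply: Or33].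
Qed.

Lemma facts_holds nm s (M : structure S (F0 S)) (v : cst -> car M) :
  holds_all v (facts nm A B s) <->
  holds_all v (pur_lits nm A ++ pur_lits nm B) /\ forall p, In p (Delta s) -> holds_atom v p.
Proof. by rewrite /facts catA holds_all_cat holds_all_pos. Qed.

Lemma leaf_in_horn n (F : 'I_n -> atom S (F0 S) cst) q x :
  leaf_in x (lsub (horn_form [seq F i | i <- enum 'I_n] q)) ->
  leaf_in x (asub q) \/ exists i, leaf_in x (asub (F i)).
Proof.
by case/In_lsub_horn=> [|[p [/In_map [i [_ ->]] xp]]]; [left|right; exists i].
Qed.

Lemma leaf_in_Leaf (F : nat -> Type) (x c : cst) : leaf_in x (subterms (Leaf c : term F cst))
  -> x = c.
Proof. by case=> // -[]. Qed.

Lemma invariant_move nm s H1 C H2 : run_invariant nm s -> Hcur s = H1 ++ C :: H2 ->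
  enabled T0 nm A B s C -> ~ mixed nm A B s C ->
  run_invariant nm (RState (com s) (den s) (H1 ++ H2) (horn_clause C :: Hsep s) (concl C ::
    Delta s)).
Proof.
move=> I eH enC nmixC.
have HC : inH K A B nm C by apply: (inv_cur I); rewrite eH; apply/In_cat; right; left.
have okC := inH_ok P_eq K_form (inv_nm I) HC.
have [//|[L LAB [cL c0L dL d0L]]] := horn_sides I okC.
have conclL x : leaf_in x (asub (concl C)) -> side nm L s x.
  by case/In_asub2=> /leaf_in_Leaf ->.
case: (I) => I1 I2 I3 I4 I5 I6 I7 I8 I9 I10 I11 I12; split=> //=.
- by move=> C' C'H; apply: I7; rewrite eH; move: C'H => /In_cat C'H; apply/In_cat; case: C'H;
  auto; right; right.
- move=> C' /I8 [|C'D]; last by right=> M MT v vD; apply: C'D => // p pD; apply: vD; right.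
  rewrite eH => /In_cat [C'H|[<-|C'H]]; [left; apply/In_cat; by left| |left; apply/In_cat;
    by right].
  by right=> M MT v; apply; left.
- move=> C' [<-|/I9 //]; exists L => // x /leaf_in_horn [/conclL //|[i]].
  case/In_asub2=> [/leaf_in_Leaf ->|/leaf_in_Leaf ->]; [exact: cL|exact: dL].
- by move=> p [<-|/I10 //]; exists L.
- move=> M MT v vL vH p pD; have vD : forall q, In q (Delta s) -> holds_atom v q.
    by apply: I11 => // C' C'H; apply: vH; right.
  case: pD => [<-|/vD //]; have /holds_horn : holds_clause v (horn_clause C) by apply: vH; left.
  by apply=> q qC; apply: (enC _ qC) => //; apply/facts_holds.
- move=> M MT v C' [<-|C'H]; last exact: I12.
  by apply: (denote_horn (X := denote (den s)) I5 _ v MT okC) => u uL; apply: (proj1 (I6 _ uL)).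
Qed.

(** The constant [c] is not [known], so earlier denotations persist. The new content is that C_1 and
    C_2 hold in T_1 once [c] denotes f(t_1,...,t_n), and that their conclusions in Delta replace the
    one of [C]. *)
Lemma invariant_separate nm s H1 C H2 (t : 'I_(hn C) -> term (F0 S) cst) (c : cst) :
  run_invariant nm s -> Hcur s = H1 ++ C :: H2 -> enabled T0 nm A B s C -> mixed nm A B s C ->
  (forall i x, leaf_in x (subterms (t i)) -> com s x) ->
  (forall i,
     entails_atom T0 (facts nm A B s) (atom2 (hRs C i) (Leaf (hc C i)) (t i)) /\
     entails_atom T0 (facts nm A B s) (atom2 (hRs C i) (t i) (Leaf (hd C i)))) ->
  ~ leaf_in c (lsub (A ++ B)) -> c \notin [seq d.1 | d <- den s] ->
  run_invariant nm
    (RState (fun x => com s x \/ x = c)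
       ((c, App (inr (hf C) : F01 S (hn C)) (fun i => embed (t i))) :: den s)
       (H1 ++ H2) (sep_clause1 t c :: sep_clause2 t c :: Hsep s)
       (atom2 (hR C) (Leaf (hcc C)) (Leaf c) ::
        atom2 (hR C) (Leaf c) (Leaf (hdd C)) :: Delta s)).
Proof.
move=> I eH enC mC tcom tsep cL ckey.
have HC : inH K A B nm C by apply: (inv_cur I); rewrite eH; apply/In_cat; right; left.
have okC := inH_ok P_eq K_form (inv_nm I) HC.
set s' := RState _ _ _ _ _.
have unknown : ~ known s c.
  by case=> // /In_mem ck; move: ckey; rewrite ck.
have Xold x : known s x -> denote (den s') x = denote (den s) x.
  by move=> kx /=; case: eqP => // xc; rewrite xc in kx.
have Xc : denote (den s') c = App (inr (hf C) : F01 S (hn C)) (fun i => bind (denote (den s))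
  (embed (t i))).
  by rewrite /= eqxx.
have com' x : com s x -> com s' x by left.
have side' L x : side nm L s x -> side nm L s' x.
  by case=> [? |? |/com' ?]; [apply: Or31|apply: Or32|apply: Or33].
have sidec L : side nm L s' c by apply: Or33; right.
have side_t L i x : leaf_in x (subterms (t i)) -> side nm L s' x.
  by move=> xt; apply: Or33; left; apply: tcom xt.
have [L [L' [LAB LAB' [cLs c0L dL d0L]]]] : exists L L', [/\ L = A \/ L = B, L' = A \/ L' = B &
    [/\ forall i, side nm L s (hc C i), side nm L s (hcc C),
        forall i, side nm L' s (hd C i) & side nm L' s (hdd C)]].
  by case: mC => -[? ? ? ?]; [exists A, B|exists B, A]; split; auto; split.
have fcom := mixed_common I okC mC.
case: (I) => I1 I2 I3 I4 I5 I6 I7 I8 I9 I10 I11 I12.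
have kL x : leaf_in x (lsub (A ++ B)) -> known s x by left.
have kN u : In u (named (A ++ B)) -> known s (nm u) by move/I6 => [_ ?]; right.
have X'leaf x : leaf_in x (lsub (A ++ B)) -> denote (den s') x = Leaf x.
  by move=> xL; rewrite Xold; [apply: I5|apply: kL].
have X'named u : In u (named (A ++ B)) -> denote (den s') (nm u) = u.
  by move=> uL; rewrite Xold; [apply: (proj1 (I6 _ uL))|apply: kN].
split=> //.
- by move=> x /I2; left.
- move=> x [/I3 [xL|xk]|->]; [by left|by right; right|by right; left].
- move=> x [xc|->]; first by rewrite Xold; [apply: I4|apply: I3].
  rewrite Xc; split=> [y|m g [a]].
    case/In_subterms_App=> [//|[i /In_subterms_bind [[z [zt yz]]|[? [? [? [_ //]]]]]]].
    have [zl _] := I4 _ (tcom _ _ (leaf_in_embed zt)); exact: zl.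
  case/In_subterms_App=> [e|[i /In_subterms_bind [[z [zt zg]]|[p [h [b [hb e]]]]]]].
  - by case: e => ? e _; subst; inj_deps; case: e => ->.
  - by have [_ zf] := I4 _ (tcom _ _ (leaf_in_embed zt)); apply: zf; exists a.
  - case: e => ? e _; subst; inj_deps; subst.
    by case: (@ext_in_embed S cst p g (t i)); exists b.
- by move=> u uL; split; [apply: X'named|right; apply: (proj2 (I6 _ uL))].
- by move=> C' C'H; apply: I7; rewrite eH; move: C'H => /In_cat C'H; apply/In_cat; case: C'H;
  auto; right; right.
- move=> C' /I8 [|C'D]; last by right=> M MT v vD; apply: C'D => // p pD; apply: vD; right; right.
  rewrite eH => /In_cat [C'H|[<-|C'H]]; [left; apply/In_cat; by left| |left; apply/In_cat;
    by right].
  (* The two conclusions meet at [c], so transitivity of R recovers the conclusion of [C]. *)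
  right=> M MT v vD; apply/holds_atom2; apply: (ok_trans okC MT (y := v c)).
    have : In (atom2 (hR C) (Leaf (hcc C)) (Leaf c)) (Delta s') by left.
    by move/vD/holds_atom2.
  have : In (atom2 (hR C) (Leaf c) (Leaf (hdd C))) (Delta s') by right; left.
  by move/vD/holds_atom2.
- move=> C' [<-|[<-|/I9]]; last exact: one_sided_mono.
    exists L => // x /leaf_in_horn [/In_asub2 [/leaf_in_Leaf ->|/leaf_in_Leaf -> //]|[i
      /In_asub2 [/leaf_in_Leaf ->|/side_t //]]];
      exact: side'.
  exists L' => // x /leaf_in_horn [/In_asub2 [/leaf_in_Leaf -> //|/leaf_in_Leaf ->]|[i
    /In_asub2 [/side_t //|/leaf_in_Leaf ->]]];
    exact: side'.
- move=> p [<-|[<-|/I10]]; last exact: one_sided_mono.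
    by exists L => // x /In_asub2 [/leaf_in_Leaf ->|/leaf_in_Leaf ->] //; apply: side'.
  by exists L' => // x /In_asub2 [/leaf_in_Leaf ->|/leaf_in_Leaf ->] //; apply: side'.
- move=> M MT v vL vH.
  have vD : forall q, In q (Delta s) -> holds_atom v q.
    by apply: I11 => // C' C'H; apply: vH; right; right.
  have vF : holds_all v (facts nm A B s) by apply/facts_holds.
  move=> p [<-|[<-|/vD //]].
    have : holds_clause v (sep_clause1 t c) by apply: vH; left.
    by move/holds_horn; apply=> q /In_map [i [_ ->]]; apply: (proj1 (tsep i)).
  have : holds_clause v (sep_clause2 t c) by apply: vH; right; left.
  by move/holds_horn; apply=> q /In_map [i [_ ->]]; apply: (proj2 (tsep i)).
- move=> M MT v; set w := fun x => _.
  have wD : defs_hold A B nm w := denote_defs X'leaf X'named v.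
  have wold x : known s x -> w x = eval v (denote (den s) x) by move=> kx; rewrite /w Xold.
  have wc : w c = ifun (inr (hf C) : F01 S (hn C)) (fun i => eval (M := reduct M) w (t i)).
    rewrite /w Xc /=; congr ifun; apply: functional_extensionality => i.
    rewrite eval_bind -eval_embed; apply: eval_eq_in => x xt.
    by apply/esym/wold; apply: I3; apply: tcom (leaf_in_embed xt).
  move=> C' [<-|[<-|C'H]].
  - apply/holds_horn => wp; apply/holds_atom2; rewrite /= wc -(wD _ _ _ _ (ok_lhs okC)).
    apply: (ok_ff okC MT) => i.
    have : In (atom2 (hRs C i) (Leaf (hc C i)) (t i)) [seq atom2 (hRs C i) (Leaf (hc C i)) (t
      i) | i <- enum 'I_(hn C)].
      by apply/In_map; exists i; split; first exact: In_enum.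
    by move/wp/holds_atom2.
  (* [ok_fg] allows arbitrary arguments x of f, in particular the values of the separating terms. *)
  - apply/holds_horn => wp; apply/holds_atom2; rewrite /= wc.
    apply: (ok_fg okC MT wD) => i.
    have : In (atom2 (hRs C i) (t i) (Leaf (hd C i))) [seq atom2 (hRs C i) (t i) (Leaf (hd C
      i)) | i <- enum 'I_(hn C)].
      by apply/In_map; exists i; split; first exact: In_enum.
    by move/wp/holds_atom2.
  (* An older clause is over one side, hence over known constants. *)
  - have := I12 _ MT v _ C'H; apply: holds_clause_eq_in => x xC'; rewrite wold //.
    by have [L0 L0AB L0s] := I9 _ C'H; apply: (side_known I L0AB); apply: L0s.
Qed.

End Run.

(** * Progress and the interpolant *)

Section Interpolation.
Variables (S : signature) (cst : eqType).
Hypothesis cst_infinite : forall l : seq cst, exists c, c \notin l.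
Variables (T0 : theory S (F0 S)) (P : Pr S 2 -> Prop).
Variable sep : seq (literal S (F0 S) cst) -> seq (literal S (F0 S) cst) ->
  Pr S 2 -> cst -> cst -> term (F0 S) cst.
Variable K : seq (clause S (F01 S) nat).
Hypotheses (T0_convex : convex cst T0) (P_eq : P (peq S)).
Hypothesis T0_P_interpolating : P_interpolating T0 P sep.
Hypothesis T0_interpolation : ground_interpolation cst T0.
Hypotheses (K_local : local_extension cst T0 K) (K_form : of_combinations T0 P K).
Variables A B : seq (literal S (F01 S) cst).
Hypothesis AB_unsat : unsat (extension T0 K) (A ++ B).

Section State.
Variables (nm : term (F01 S) cst -> cst) (s : rstate S cst).
Hypothesis I : run_invariant T0 K A B nm s.

(** A trivial literal that makes [x] occur in a conjunction: [P_interpolating] asks for the two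
    related constants to occur in the two conjunctions, whereas a constant of a side may occur only
    in definitions. *)
Definition reflexivity (x : cst) : literal S (F0 S) cst :=
  (true, atom2 (peq S) (Leaf x) (Leaf x)).

(** Delta is distributed over the two sides, atoms over common constants going to both, and this
    keeps the conjunction equivalent to the facts. Constants shared by the two halves lie on both
    sides, hence are common. [a'] and [b'] are the same two constants ordered by side, since a
    premise may run from B to A. *)
Lemma separating_term R a b a' b' : P R -> side nm A s a' -> side nm B s b' ->
  (a = a' /\ b = b') \/ (a = b' /\ b = a') ->
  entails_atom T0 (facts nm A B s) (atom2 R (Leaf a) (Leaf b)) ->
  exists t, [/\ forall x, leaf_in x (subterms t) -> com s x,
    entails_atom T0 (facts nm A B s) (atom2 R (Leaf a) t)
  & entails_atom T0 (facts nm A B s) (atom2 R t (Leaf b))].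
Proof.
move=> PR a'A b'B aabb ent.
pose over L (p : atom S (F0 S) cst) := forall x, leaf_in x (asub p) -> side nm L s x.
have [DA DAP] := ex_filter (over A) (Delta s).
have [DB DBP] := ex_filter (over B) (Delta s).
pose A' := pur_lits nm A ++ [seq (true, p) | p <- DA] ++ [:: reflexivity a'].
pose B' := pur_lits nm B ++ [seq (true, p) | p <- DB] ++ [:: reflexivity b'].
have AB' (M : structure S (F0 S)) (v : cst -> car M) :
    holds_all v (A' ++ B') <-> holds_all v (facts nm A B s).
  have refl x : holds_all v [:: reflexivity x].
    by move=> l [<-|//]; apply/holds_atom2; apply/irel_eq.
  rewrite facts_holds !holds_all_cat !holds_all_pos; split.
    case=> -[vA [vDA _]] [vB [vDB _]]; split=> // p pD.
    have [L [->|->] Lp] := inv_Delta I pD; [apply: vDA; apply/DAP|apply: vDB; apply/DBP];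
      by split.
  case=> -[vA vB] vD; split; split=> //; split=> // p; [case/DAP|case/DBP] => pD _; exact: vD.
have entE p : entails_atom T0 (A' ++ B') p <-> entails_atom T0 (facts nm A B s) p.
  by split=> e M MT v vL; apply: e => //; apply/AB'.
have sideL L D' c' x : (forall p, In p D' <-> In p (Delta s) /\ over L p) -> side nm L s c' ->
    leaf_in x (lsub (pur_lits nm L ++ [seq (true, p) | p <- D'] ++ [:: reflexivity c'])) ->
    side nm L s x.
  move=> D'P c'L /In_lsub_cat [xL|/In_lsub_cat [|]]; first exact: Or31.
    by case/In_lsub=> l [/In_map [p [/D'P [_ pL] ->]]] /pL.
  by case/In_lsub=> l [[<-|//] /In_asub2 [/leaf_in_Leaf ->|/leaf_in_Leaf ->]].
have inL L D' c' : leaf_in c'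
    (lsub (pur_lits nm L ++ [seq (true, p) | p <- D'] ++ [:: reflexivity c'])).
  apply/In_lsub_cat; right; apply/In_lsub_cat; right; apply/In_lsub.
  by exists (reflexivity c'); split; [left|apply/In_asub2; left; left].
have [|ct e1 e2] := T0_P_interpolating (A := A') (B := B') PR (a := a) (b := b) _ (iffRL (entE
  _) ent).
  by case: aabb => -[-> ->]; [left|right]; split; apply: inL.
exists (sep A' B' R a b); split; [|exact/entE|exact/entE].
move=> x /ct [xA xB]; apply: (side_both I).
  exact: sideL DAP a'A xA.
exact: sideL DBP b'B xB.
Qed.

Lemma separating_terms C : inH K A B nm C -> enabled T0 nm A B s C -> mixed nm A B s C ->
  exists t : 'I_(hn C) -> term (F0 S) cst,
  (forall i x, leaf_in x (subterms (t i)) -> com s x) /\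
  forall i,
    entails_atom T0 (facts nm A B s) (atom2 (hRs C i) (Leaf (hc C i)) (t i)) /\
    entails_atom T0 (facts nm A B s) (atom2 (hRs C i) (t i) (Leaf (hd C i))).
Proof.
move=> HC enC mC; have okC := inH_ok P_eq K_form (inv_nm I) HC.
have tP i : {t | [/\ forall x, leaf_in x (subterms t) -> com s x,
    entails_atom T0 (facts nm A B s) (atom2 (hRs C i) (Leaf (hc C i)) t)
  & entails_atom T0 (facts nm A B s) (atom2 (hRs C i) t (Leaf (hd C i)))]}.
  apply: constructive_indefinite_description.
  have ent : entails_atom T0 (facts nm A B s) (atom2 (hRs C i) (Leaf (hc C i)) (Leaf (hd C i))).
    by apply: enC; apply/In_map; exists i; split; first exact: In_enum.
  case: mC => -[cs' _ ds' _].
    by apply: (separating_term (a' := hc C i) (b' := hd C i)) ent => //; [apply: (ok_P okC)|left].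
  by apply: (separating_term (a' := hd C i) (b' := hc C i)) ent => //; [apply: (ok_P okC)|right].
exists (fun i => proj1_sig (tP i)); split=> i; by case: (proj2_sig (tP i)).
Qed.

(* By convexity some model of the facts refutes one premise of every remaining
   clause; there all of H holds, which [base_reduction] forbids. *)
Lemma final_unsat : (forall C, In C (Hcur s) -> ~ enabled T0 nm A B s C) ->
  forall M, T0 M -> forall v : cst -> car M,
    holds_all v (pur_lits nm A ++ pur_lits nm B) -> ~ holds_clauses v (Hsep s).
Proof.
move=> stuck M MT v vL vH.
have vF : holds_all v (facts nm A B s).
  by apply/facts_holds; split=> //; apply: (inv_sep_Delta I MT vL vH).
have [ps psP] := ex_filter (fun p => ~ entails_atom T0 (facts nm A B s) p)
  (flatten [seq prem C | C <- Hcur s]).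
(* Convexity speaks of atoms only, so the negative facts join the disjunction of atoms to be
   refuted. *)
pose pos := [seq l.2 | l <- facts nm A B s & l.1].
pose neg := [seq l.2 | l <- facts nm A B s & ~~ l.1].
have posP (N : structure S (F0 S)) (w : cst -> car N) : holds_all w (facts nm A B s) <->
    holds_all w [seq (true, p) | p <- pos] /\ forall p, In p neg -> ~ holds_atom w p.
  rewrite holds_all_pos; split=> [wF|[wp wn] [[] p] pF].
  - split=> p /In_map [[b q] [/In_filter [pF pb] ->]]; move: (wF _ pF) pb; by case: b {pF}.
  - by apply: wp; apply/In_map; exists (true, p); split=> //; apply/In_filter.
  - by apply: wn; apply/In_map; exists (false, p); split=> //; apply/In_filter.
have [N [NT [w [wpos wq]]]] : exists N, T0 N /\ exists w : cst -> car N,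
    holds_all w [seq (true, p) | p <- pos] /\ forall p, In p (ps ++ neg) -> ~ holds_atom w p.
  (* Convexity requires a nonempty disjunction; if nothing has to be refuted, [M] itself serves. *)
  have [e|ne] := classic (ps ++ neg = [::]).
    by exists M; split=> //; exists v; rewrite e; split=> //; case: (iffLR (posP _ _) vF).
  apply: NNPP => noN; have [|p [pq ep]] := T0_convex (Gamma := pos) ne.
    move=> N NT w wpos; apply: NNPP => now; apply: noN; exists N; split=> //; exists w;
      split=> //.
    by move=> p pq wp; apply: now; exists p.
  (* An entailed atom of [ps] contradicts the choice of [ps]; one of [neg] contradicts that [M]
     satisfies the facts. *)
  case/In_cat: pq => [/psP [_]|pn].
    by apply=> N NT w /posP [wpos _]; apply: ep.
  by have [vpos vneg] := iffLR (posP _ _) vF; case: (vneg _ pn); apply: ep.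
have /facts_holds [wL wD] : holds_all w (facts nm A B s).
  by apply/posP; split=> // p pn; apply: wq; apply/In_cat; right.
apply: (base_reduction K_local K_form AB_unsat NT wL) => C HC; apply/holds_horn => wC.
case: (inv_done I HC) => [CH|]; last by apply.
case: (stuck _ CH) => p pC; apply: NNPP => np.
apply: (wq p); last exact: wC.
by apply/In_cat; left; apply/psP; split=> //; apply/In_flatten; exists C.
Qed.

Lemma separated_part_finite L : exists Lbar, forall C, In C Lbar <-> separated_part nm A B s L C.
Proof.
apply: (ex_sublist (l := [seq [:: l] | l <- pur_lits nm L] ++
  [seq horn_clause h | h <- Hcur s] ++ Hsep s)) => C [[l [lL ->]]|[[[h [hH _ ->]]|CH] _]];
  apply/In_cat.
- by left; apply/In_map; exists l.
- by right; apply/In_cat; left; apply/In_map; exists h.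
- by right; apply/In_cat; right.
Qed.

Lemma separated_part_leaf L Lbar x : (forall C, In C Lbar <-> separated_part nm A B s L C) ->
  leaf_in x (lsub (flatten Lbar)) -> side nm L s x.
Proof.
move=> LP /In_lsub [l [lL xl]].
have [C [/LP CL lC]] : exists C, In C Lbar /\ In l C.
  by move: lL; rewrite -[in flatten _](map_id Lbar) => /In_flatten.
case: CL lC => [[l' [lL' ->]] [e|//]|[_ Cs] lC].
  by apply: Or31; apply/In_lsub; exists l; rewrite -e in xl *.
by apply: Cs; apply/In_lsub; exists l.
Qed.

(** [final_unsat] refutes A_0, B_0 and H_sep together, and each clause of H_sep is over one side, so
    all of them belong to [Abar] or [Bbar]. *)
Lemma separated_unsat Abar Bbar : (forall C, In C (Hcur s) -> ~ enabled T0 nm A B s C) ->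
  (forall C, In C Abar <-> separated_part nm A B s A C) ->
  (forall C, In C Bbar <-> separated_part nm A B s B C) ->
  unsat_clauses T0 (Abar ++ Bbar).
Proof.
move=> stuck AP BP M MT v vAB.
have vpur L Lbar l : (forall C, In C Lbar <-> separated_part nm A B s L C) ->
    (forall C, In C Lbar -> In C (Abar ++ Bbar)) -> In l (pur_lits nm L) -> holds_lit v l.
  move=> LP LAB lL; have : holds_clause v [:: l].
    by apply: vAB; apply: LAB; apply/LP; left; exists l.
  by case=> l' [[<-|//]].
apply: (final_unsat stuck MT (v := v)) => [l /In_cat [lA|lB]|C CH].
- by apply: (vpur _ _ _ AP) lA => C CA; apply/In_cat; left.
- by apply: (vpur _ _ _ BP) lB => C CB; apply/In_cat; right.
- apply: vAB; have [L LAB CL] := inv_sep I CH; apply/In_cat.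
  by case: LAB CL => -> CL; [left; apply/AP|right; apply/BP]; right; split=> //; right.
Qed.

Lemma denote_separated (M : structure S (F01 S)) (v : cst -> car M) L Lbar :
  extension T0 K M -> (forall t, In t (lsub L) -> In t (lsub (A ++ B))) -> holds_all v L ->
  (forall C, In C Lbar <-> separated_part nm A B s L C) ->
  holds_clauses (M := reduct M) (fun x => eval v (denote (den s) x)) Lbar.
Proof.
move=> MT LAB vL LP C /LP.
have Xl := inv_leaf I; have Xn t tL := proj1 (inv_named I (t := t) tL).
case=> [[l [lL ->]]|[[[h [hH _ ->]]|CH] _]].
- by exists l; split; [left|apply: (denote_pur_lits Xl Xn LAB vL)].
- by apply: (denote_horn Xl Xn v MT (P := P)); apply: (inH_ok P_eq K_form (inv_nm I));
  apply: (inv_cur I).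
- exact: (inv_sound I MT).
Qed.

Lemma expand_interpolant Abar Bbar I0 :
  (forall C, In C Abar <-> separated_part nm A B s A C) ->
  (forall C, In C Bbar <-> separated_part nm A B s B C) ->
  interpolant0 T0 Abar Bbar I0 -> interpolant T0 K A B (expand (den s) I0).
Proof.
move=> AP BP [I0c I0A I0B]; rewrite expandE.
have xcom w x : In w (fsub I0) -> leaf_in x (subterms w) -> common_symbols K A B (subterms
  (denote (den s) x)).
  move=> wI xw; apply: (inv_com_denote I).
  have [xA xB] := I0c _ (fsub_trans xw wI).
  by apply: (side_both I); [apply: separated_part_leaf AP xA|apply: separated_part_leaf BP xB].
split.
(* A subterm of the expansion lies inside a denotation or starts with a base symbol, so constants
   and extension functions come from denotations only. *)
- have origin_of u : In u (fsub (fbind (denote (den s)) (fembed I0))) ->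
      (exists w x, [/\ In w (fsub I0), leaf_in x (subterms w) & In u (subterms (denote (den s)
        x))]) \/
      exists n (f : F0 S n) a, u = App (inl f : F01 S n) a.
    case/In_fsub_fbind=> _ [/In_fsub_fembed [w [wI ->]] /In_subterms_bind].
    case=> [[x [xw ux]]|[n [f [a [fw ->]]]]].
      by left; exists w, x; split=> //; apply: leaf_in_embed.
    case: f fw => [f _|f fw]; first by right; exists n, f; eexists.
    by case: (@ext_in_embed S cst n f w); exists a.
  split=> [c|n f [a]] /origin_of [[w [x [wI xw ux]]]|[m [g [b e]]]] //.
  + exact: (proj1 (xcom _ _ wI xw)).
  + by apply: (proj2 (xcom _ _ wI xw)); exists a.
- move=> M MT v vA; apply/holds_fbind/holds_fembed; apply: I0A; first by case: MT.
  by apply: (denote_separated MT _ vA AP) => t tA; apply/In_lsub_cat; left.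
- move=> M MT v [/holds_fbind /holds_fembed vI vB].
  apply: (I0B (reduct M) (proj1 MT)); split; first exact: vI.
  by apply: (denote_separated MT _ vB BP) => t tB; apply/In_lsub_cat; right.
Qed.

Lemma reduce_progress : exists c, step T0 K A B (Reduce nm s) c.
Proof.
have [[C [CH enC]]|nen] := classic (exists C, In C (Hcur s) /\ enabled T0 nm A B s C).
  have [H1 [H2 eH]] := List.in_split C (Hcur s) CH.
  have [mC|nmC] := classic (mixed nm A B s C); last by eexists; apply: step_move eH enC nmC.
  have [t [tcom tsep]] := separating_terms (inv_cur I CH) enC mC.
  have [c] := cst_infinite (leaves (lsub (A ++ B)) ++ [seq d.1 | d <- den s]).
  rewrite mem_cat negb_or => /andP [/negP cL ck].
  eexists; apply: step_separate eH enC mC tcom tsep _ ck.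
  by move=> xL; apply: cL; apply/In_mem; apply: In_leaves.
have stuck C : In C (Hcur s) -> ~ enabled T0 nm A B s C by move=> CH enC; apply: nen; exists C.
have [Abar AP] := separated_part_finite A; have [Bbar BP] := separated_part_finite B.
have [I0 I0P] := T0_interpolation (separated_unsat stuck AP BP).
by eexists; apply: step_interpolate stuck AP BP I0P.
Qed.

End State.

Definition sound_config (c : config S cst) : Prop :=
  match c with
  | Start => True
  | Reduce nm s => run_invariant T0 K A B nm s
  | Interpolated dn I0 => interpolant T0 K A B (expand dn I0)
  | Done J => interpolant T0 K A B J
  end.

Lemma step_sound c c' : step T0 K A B c c' -> sound_config c -> sound_config c'.
Proof.
case=> //=.
- by move=> nm H nmP HP _; apply: invariant_initial.
- move=> nm s H1 C H2 t x eH enC mC tcom tsep xL xk I.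
  by apply: (invariant_separate P_eq K_form I eH enC mC).
- by move=> nm s H1 C H2 eH enC nmC I; apply: (invariant_move P_eq K_form I eH).
- by move=> nm s Abar Bbar I0 _ AP BP I0P I; apply: (expand_interpolant I AP BP I0P).
Qed.

Lemma start_progress : exists c, step T0 K A B Start c.
Proof.
have [nm nmP] := ex_naming cst_infinite A B.
have [H HP] := inH_finite K_form A B nm.
by eexists; apply: step_purify nmP HP.
Qed.

Lemma run_terminates : terminates T0 K A B.
Proof.
(* The offset 2 keeps reductions above the two final configurations. [Start] is excluded from the
   decrease: H is fixed only up to repetitions, so its length after purification has no bound, but
   [Start] is never reached again. *)
pose measure (c : config S cst) :=
  match c with Start => 0 | Reduce _ s => (size (Hcur s)).+2 | Interpolated _ _ => 1 | Done _
    => 0 end.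
have decr c c' : step T0 K A B c c' -> c' <> Start /\ (c <> Start -> measure c' < measure c).
  case=> //=.
  - by move=> nm s H1 C H2 t x -> *; split=> // _; rewrite !ltnS !size_cat /= addnS.
  - by move=> nm s H1 C H2 -> *; split=> // _; rewrite !ltnS !size_cat /= addnS.
have acc n : forall c, c <> Start -> measure c < n -> Acc (fun s' s => step T0 K A B s s') c.
  elim: n => [//|n IH] c cS cn; constructor=> c' /decr [c'S /(_ cS) c'c].
  by apply: IH => //; apply: leq_trans c'c _.
by constructor=> c /decr [cS _]; apply: (acc (measure c).+1).
Qed.

Lemma run_computes : computes_interpolant T0 K A B.
Proof.
move=> c run stuck.
have : sound_config c.
  have : sound_config Start by [].
  elim: run => [x y|//|x y z _ xy _ yz]; [exact: step_sound|by move/xy/yz].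
case: c {run} stuck => [|nm s|dn I0|I] stuck cI.
- by case: stuck; apply: start_progress.
- by case: stuck; apply: reduce_progress.
- by case: stuck; eexists; apply: step_expand.
- by exists I.
Qed.

End Interpolation.

Theorem theorem6p2 (S : signature) (cst : eqType)
    (cst_infinite : forall l : seq cst, exists c, c \notin l)
    (T0 : theory S (F0 S)) (P : Pr S 2 -> Prop)
    (sep : seq (literal S (F0 S) cst) -> seq (literal S (F0 S) cst) ->
           Pr S 2 -> cst -> cst -> term (F0 S) cst)
    (K : seq (clause S (F01 S) nat))
    (T0_convex : convex cst T0)
    (P_eq : P (peq S))
    (T0_P_interpolating : P_interpolating T0 P sep)
    (T0_interpolation : ground_interpolation cst T0)
    (K_local : local_extension cst T0 K)
    (K_form : of_combinations T0 P K)
    (A B : seq (literal S (F01 S) cst))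
    (AB_unsat : unsat (extension T0 K) (A ++ B)) :
  terminates T0 K A B /\ computes_interpolant T0 K A B.
Proof.
split; first exact: run_terminates.
exact: (run_computes cst_infinite T0_convex P_eq T0_P_interpolating
  T0_interpolation K_local K_form AB_unsat).
Qed.
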